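(* Suppose that $S$ is a dense set in a normed space $X$ and let $T:S\to S$ be a step-isometry. Then $T$ is necessarily continuous (with respect to the norm topology) if any of the following is true: \begin{enumerate} \item $X$ is reflexive. \item $X$ is the dual of an Asplund space (this includes all separable dual spaces). \item $X=C(K)$ for some compact $K$. \item $X=C_b(K)$ for some topological space $K$. \item $X=L_1(0,1)$. \end{enumerate}
   Context: All normed spaces are real. A bijection $T:S\to S$ of a dense set $S\subseteq X$ (possibly $S=X$) is a step-isometry if for all $x,y\in S$ we have $\lfloor\|x-y\|\rfloor=\lfloor\|T(x)-T(y)\|\rfloor$; equivalently, for every positive integer $k$ and all $x,y\in S$, $\|x-y\|<k$ if and only if $\|T(x)-T(y)\|<k$. An Asplund space is a Banach space every separable subspace of which has separable dual. $C(K)$ is the space of continuous real functions on $K$ and $C_b(K)$ is the space of bounded continuous real functions on $K$, both with the sup norm. *)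

(* Defs.v *)
From HB Require Import structures.
From mathcomp Require Import all_boot all_order all_algebra.
From mathcomp Require Import generic_quotient.
From mathcomp Require Import all_classical all_reals all_analysis.
From mathcomp Require Import measurable_realfun ess_sup_inf ring.

Set Implicit Arguments.
Unset Strict Implicit.
Unset Printing Implicit Defensive.
Import Order.TTheory GRing.Theory Num.Theory.
Import numFieldNormedType.Exports.
Local Open Scope classical_set_scope.
Local Open Scope ring_scope.

Section supnorm.
Context {R : realType} {I : Type}.
Implicit Types (A : set I) (f g : I -> R^o) (M : R).

(* The supremum of the empty set is 0, so supnorm is 0 when A is empty. *)
Definition supnorm A f : R := sup [set `|f x| | x in A].

Definition bounded_over A f := exists M, forall x, A x -> `|f x| <= M.

Lemma supnorm_le A f M : 0 <= M -> (forall x, A x -> `|f x| <= M) ->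
  supnorm A f <= M.
Proof.
move=> M0 fM; rewrite /supnorm.
have [->|A0] := eqVneq A set0; first by rewrite image_set0 sup0.
apply: ge_sup; first by apply: image_nonempty; exact/set0P.
by move=> _ [x Ax <-]; exact: fM.
Qed.

Lemma le_supnorm A f x : bounded_over A f -> A x -> `|f x| <= supnorm A f.
Proof.
move=> [M fM] Ax; apply: ub_le_sup; last by exists x.
by exists M => _ [y Ay <-]; exact: fM.
Qed.

Lemma supnorm_ge0 A f : bounded_over A f -> 0 <= supnorm A f.
Proof.
move=> bf; have [->|/set0P[x Ax]] := eqVneq A set0.
  by rewrite /supnorm image_set0 sup0.
by rewrite (le_trans _ (le_supnorm bf Ax)).
Qed.

Lemma supnormD A f g : bounded_over A f -> bounded_over A g ->
  supnorm A (f + g) <= supnorm A f + supnorm A g.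
Proof.
move=> bf bg; apply: supnorm_le => [|x Ax].
  by rewrite addr_ge0// supnorm_ge0.
by rewrite (le_trans (ler_normD _ _))// lerD// le_supnorm.
Qed.

Lemma bounded_overZ A a f : bounded_over A f -> bounded_over A (a *: f).
Proof.
move=> [M fM]; exists (`|a| * M) => x Ax.
by rewrite [X in `|X|]/(a * f x) normrM ler_wpM2l// fM.
Qed.

Lemma bounded_overD A f g :
  bounded_over A f -> bounded_over A g -> bounded_over A (f + g).
Proof.
move=> [M fM] [N gN]; exists (M + N) => x Ax.
by rewrite (le_trans (ler_normD _ _))// lerD ?fM ?gN.
Qed.

Lemma supnormZ A a f : bounded_over A f ->
  supnorm A (a *: f) = `|a| * supnorm A f.
Proof.
have leZ b g : bounded_over A g -> supnorm A (b *: g) <= `|b| * supnorm A g.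
  move=> bg; apply: supnorm_le => [|x Ax]; first by rewrite mulr_ge0 ?supnorm_ge0.
  by rewrite [X in `|X|]/(b * g x) normrM ler_wpM2l// le_supnorm.
move=> bf; apply/eqP; rewrite eq_le leZ//=.
have [->|a0] := eqVneq a 0.
  by rewrite normr0 mul0r supnorm_ge0//; exact: bounded_overZ.
rewrite -ler_pdivlMl ?normr_gt0// -normfV.
rewrite -{1}[f](scalerK a0); apply: leZ; exact: bounded_overZ.
Qed.

Lemma supnorm_eq0 A f x : bounded_over A f -> supnorm A f = 0 -> A x -> f x = 0.
Proof.
move=> bf f0 Ax; apply/eqP; rewrite -normr_eq0 eq_le normr_ge0 andbT.
by rewrite -f0 le_supnorm.
Qed.

End supnorm.

Section dual.
Context {R : realType} (V : normedModType R).

Definition dual_pred : {pred V -> R^o} :=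
  mem [set f : V -> R^o | linear f /\ continuous f].

Lemma dual_submod_closed : submod_closed dual_pred.
Proof.
split.
  rewrite inE; split; last exact: cst_continuous.
  by move=> a x y; rewrite /= scaler0 addr0.
move=> a f g; rewrite !inE => -[lf cf] [lg cg]; split.
  move=> b x y; rewrite [LHS]/(a * f (b *: x + y) + g (b *: x + y)) lf lg.
  have E (p q r s : R) :
    a * (b * p + q) + (b * r + s) = b * (a * p + r) + (a * q + s) by ring.
  exact: E.
move=> x; apply: continuousD; last exact: cg.
exact: (@continuousZl_tmp R R^o _ f a x (cf x)).
Qed.

HB.instance Definition _ :=
  GRing.isSubmodClosed.Build R (V -> R^o) dual_pred dual_submod_closed.

Record dual := Dual {
  dual_fun :> V -> R^o;
  dual_funP : dual_fun \in dual_pred }.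

HB.instance Definition _ := [isSub for dual_fun].
HB.instance Definition _ := [Choice of dual by <:].
HB.instance Definition _ := [SubChoice_isSubLmodule of dual by <:].

Definition dual_norm (f : dual) := supnorm [set x : V | `|x| <= 1] f.

Lemma dual_bounded (f : dual) : bounded_over [set x : V | `|x| <= 1] f.
Proof.
have := dual_funP f; rewrite inE => -[lf cf].
pose g : {linear V -> R^o} := HB.pack (f : V -> R^o)
  (GRing.isLinear.Build R V R^o *:%R f lf).
have /linear_boundedP/pinfty_ex_gt0[M M0 fM] : bounded_near g (nbhs (0 : V)).
  by apply/linear_bounded_continuous; exact: cf.
exists M => x x1; rewrite (le_trans (fM x))// -[leRHS]mulr1.
by rewrite ler_wpM2l// ltW.
Qed.

Let dual_normD f g : dual_norm (f + g) <= dual_norm f + dual_norm g.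
Proof. exact: supnormD (dual_bounded f) (dual_bounded g). Qed.

Let dual_normZ a f : dual_norm (a *: f) = `|a| * dual_norm f.
Proof. exact: supnormZ (dual_bounded f). Qed.

Let dual_norm_eq0 f : dual_norm f = 0 -> f = 0.
Proof.
move=> f0; have := dual_funP f; rewrite inE => -[lf _].
pose g : {linear V -> R^o} := HB.pack (f : V -> R^o)
  (GRing.isLinear.Build R V R^o *:%R f lf).
apply/val_inj/funext => x; rewrite [RHS]/(0 : R).
have [->|x0] := eqVneq x 0; first exact: (linear0 g).
have : f (`|x|^-1 *: x) = 0.
  apply: (supnorm_eq0 (dual_bounded f) f0) => /=.
  by rewrite normrZ normfV normr_id mulVf ?normr_eq0.
rewrite [f _](linearZ_LR g) => /eqP; rewrite mulf_eq0 invr_eq0 normr_eq0.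
by rewrite (negPf x0) => /eqP.
Qed.

HB.instance Definition _ := Lmodule_isNormed.Build R dual
  dual_normD dual_normZ dual_norm_eq0.

End dual.

Section bounded_continuous.
Context (R : realType) (K : topologicalType).

Definition Cb_pred : {pred K -> R^o} :=
  mem [set f : K -> R^o | continuous f /\ bounded_over setT f].

Lemma Cb_submod_closed : submod_closed Cb_pred.
Proof.
split.
  rewrite inE; split; first exact: cst_continuous.
  by exists 0 => x _; rewrite normr0.
move=> a f g; rewrite !inE => -[cf bf] [cg bg]; split.
  move=> x; apply: continuousD; last exact: cg.
  exact: (@continuousZl_tmp R R^o _ f a x (cf x)).
by apply: bounded_overD => //; exact: bounded_overZ.
Qed.

HB.instance Definition _ :=
  GRing.isSubmodClosed.Build R (K -> R^o) Cb_pred Cb_submod_closed.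

Record Cb := MkCb { Cb_fun :> K -> R^o; Cb_funP : Cb_fun \in Cb_pred }.

HB.instance Definition _ := [isSub for Cb_fun].
HB.instance Definition _ := [Choice of Cb by <:].
HB.instance Definition _ := [SubChoice_isSubLmodule of Cb by <:].

Definition Cb_norm (f : Cb) := supnorm setT f.

Lemma Cb_bounded (f : Cb) : bounded_over setT f.
Proof. by have := Cb_funP f; rewrite inE => -[]. Qed.

Let Cb_normD f g : Cb_norm (f + g) <= Cb_norm f + Cb_norm g.
Proof. exact: supnormD (Cb_bounded f) (Cb_bounded g). Qed.

Let Cb_normZ a f : Cb_norm (a *: f) = `|a| * Cb_norm f.
Proof. exact: supnormZ (Cb_bounded f). Qed.

Let Cb_norm_eq0 f : Cb_norm f = 0 -> f = 0.
Proof.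
by move=> f0; apply/val_inj/funext => x; exact: supnorm_eq0 (Cb_bounded f) f0 _.
Qed.

HB.instance Definition _ := Lmodule_isNormed.Build R Cb
  Cb_normD Cb_normZ Cb_norm_eq0.

End bounded_continuous.

Section compact_continuous.
Context (R : realType) (K : topologicalType).

Definition C_pred : {pred K -> R^o} := mem [set f : K -> R^o | continuous f].

Lemma C_submod_closed : submod_closed C_pred.
Proof.
split; first by rewrite inE; exact: cst_continuous.
move=> a f g; rewrite !inE => cf cg x; apply: continuousD; last exact: cg.
exact: (@continuousZl_tmp R R^o _ f a x (cf x)).
Qed.

HB.instance Definition _ :=
  GRing.isSubmodClosed.Build R (K -> R^o) C_pred C_submod_closed.

(* The compactness proof is a parameter of the type: the supremum norm is a
   norm on continuous functions only because they are bounded. *)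
Record C (cK : compact [set: K]) := MkC {
  C_fun :> K -> R^o;
  C_funP : C_fun \in C_pred }.

Context (cK : compact [set: K]).

HB.instance Definition _ := [isSub of C cK for @C_fun cK].
HB.instance Definition _ := [Choice of C cK by <:].
HB.instance Definition _ := [SubChoice_isSubLmodule of C cK by <:].

Definition C_norm (f : C cK) := supnorm setT f.

Lemma C_bounded (f : C cK) : bounded_over setT f.
Proof.
have := C_funP f; rewrite inE => cf.
have : compact (f @` [set: K]).
  by apply: continuous_compact => //; exact: continuous_subspaceT.
move=> /compact_bounded/pinfty_ex_gt0[M _ fM].
by exists M => x _; apply: fM; exists x.
Qed.

Let C_normD f g : C_norm (f + g) <= C_norm f + C_norm g.
Proof. exact: supnormD (C_bounded f) (C_bounded g). Qed.

Let C_normZ a f : C_norm (a *: f) = `|a| * C_norm f.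
Proof. exact: supnormZ (C_bounded f). Qed.

Let C_norm_eq0 f : C_norm f = 0 -> f = 0.
Proof.
by move=> f0; apply/val_inj/funext => x; exact: supnorm_eq0 (C_bounded f) f0 _.
Qed.

HB.instance Definition _ := Lmodule_isNormed.Build R (C cK)
  C_normD C_normZ C_norm_eq0.

End compact_continuous.

Section subspace.
Context {R : realType} {V : normedModType R} (M : submodClosed V).

Record subspace_of := Subspace {
  subspace_val :> V;
  subspace_valP : subspace_val \in M }.

HB.instance Definition _ := [isSub for subspace_val].
HB.instance Definition _ := [Choice of subspace_of by <:].
HB.instance Definition _ := [SubChoice_isSubLmodule of subspace_of by <:].

Definition subspace_norm (x : subspace_of) : R := `|val x|.

Let subspace_normD x y :
  subspace_norm (x + y) <= subspace_norm x + subspace_norm y.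
Proof. exact: ler_normD. Qed.

Let subspace_normZ a x : subspace_norm (a *: x) = `|a| * subspace_norm x.
Proof. exact: normrZ. Qed.

Let subspace_norm_eq0 x : subspace_norm x = 0 -> x = 0.
Proof. by move=> /normr0_eq0 x0; exact: val_inj. Qed.

HB.instance Definition _ := Lmodule_isNormed.Build R subspace_of
  subspace_normD subspace_normZ subspace_norm_eq0.

End subspace.

Section Lspace.
Context d (T : measurableType d) (R : realType).
Variables (mu : {measure set T -> \bar R}) (p : \bar R) (p1 : (1 <= p)%E).
Local Notation L := (LspaceType mu p1).
Local Open Scope quotient_scope.

HB.instance Definition _ := gen_eqMixin L.
HB.instance Definition _ := gen_choiceMixin L.

Lemma ae_Lnorm (f g : T -> R) :
  measurable_fun setT f -> measurable_fun setT g -> f = g %[ae mu] ->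
  'N[mu]_p[EFin \o f]%E = 'N[mu]_p[EFin \o g]%E.
Proof.
move=> mf mg fg; rewrite unlock; case: p p1 => [r r1|_|//].
  congr (_ `^ _)%E; apply: ae_eq_integral => //.
  - apply: (@measurableT_comp _ _ _ _ _ _ (fun x => x `^ r)%E) => //=.
      exact: (measurableT_comp (measurable_poweR _)).
    by apply: measurableT_comp => //; apply: measurableT_comp.
  - apply: (@measurableT_comp _ _ _ _ _ _ (fun x => x `^ r)%E) => //=.
      exact: (measurableT_comp (measurable_poweR _)).
    by apply: measurableT_comp => //; apply: measurableT_comp.
  by apply: filterS fg => x + Dx => /(_ Dx) /= ->.
case: ifP => // _; apply: eq_ess_sup.
by apply: filterS fg => x /(_ I) /= ->.
Qed.

Lemma Lspace_measurable (f : {mfun_ mu, T >-> measurableTypeR R}) :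
  measurable_fun setT (f : T -> R).
Proof. exact: (@measurable_funPT _ _ _ _ (repr f)). Qed.

Lemma Lspace_Lfun (f : L) : (f : T -> R) \in Lfun mu p.
Proof.
rewrite inE; apply/andP; split; rewrite inE/=; last exact: Lebesgue_finite.
exact: Lspace_measurable.
Qed.

Definition Lrepr (f : L) : LfunType mu p1 := Lfun_Sub p1 (Lspace_Lfun f).

Lemma Lfun_mfunR (f : LfunType mu p1) :
  (f : T -> measurableTypeR R) \in @mfun _ _ T (measurableTypeR R).
Proof. by rewrite inE; exact: (@measurable_funPT _ _ _ _ f). Qed.

Definition aeclass (f : LfunType mu p1) : {mfun_ mu, T >-> measurableTypeR R} :=
  \pi_({mfun_ mu, T >-> measurableTypeR R}) (mfun_Sub (Lfun_mfunR f)).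

Lemma aeclassE (f : LfunType mu p1) : (aeclass f : T -> R) = f %[ae mu].
Proof.
have /eqP := reprK (aeclass f).
by rewrite /aeclass eqmodE => /asboolP.
Qed.

Lemma aeclass_fin (f : LfunType mu p1) : finite_norm mu p (aeclass f : T -> R).
Proof.
rewrite /finite_norm (@ae_Lnorm _ f); first exact: Lfunction_finite.
- exact: Lspace_measurable.
- exact: (@measurable_funPT _ _ _ _ f).
- exact: aeclassE.
Qed.

Definition Lpi (f : LfunType mu p1) : L :=
  HB.pack (aeclass f) (isFinLebesgue.Build d T R mu p p1 (aeclass f) (aeclass_fin f)).

Lemma LpiE (f : LfunType mu p1) : Lrepr (Lpi f) = f %[ae mu].
Proof. exact: aeclassE. Qed.

Lemma Lspace_aeP (f g : L) : Lrepr f = Lrepr g %[ae mu] -> f = g.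
Proof.
case: f => f [[Hf]]; case: g => g [[Hg]] fg.
have E : f = g.
  rewrite -[f]reprK -[g]reprK; apply/eqP; rewrite eqmodE; apply/asboolP; exact: fg.
by move: Hf Hg fg; rewrite E => Hf Hg _; rewrite (Prop_irrelevance Hf Hg).
Qed.

(* L^p inherits its vector space structure from LfunType through canonical
   representatives of the classes. *)
Definition Ladd (f g : L) : L := Lpi (Lrepr f + Lrepr g).
Definition Lopp (f : L) : L := Lpi (- Lrepr f).
Definition Lscale (a : R) (f : L) : L := Lpi (a *: Lrepr f).
Definition Lzero : L := Lpi 0.

Let LaddE f g : \forall x \ae mu, Lrepr (Ladd f g) x = Lrepr f x + Lrepr g x.
Proof. by apply: filterS (LpiE _) => x E; exact: E. Qed.

Let LoppE f : \forall x \ae mu, Lrepr (Lopp f) x = - Lrepr f x.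
Proof. by apply: filterS (LpiE _) => x E; exact: E. Qed.

Let LscaleE a f : \forall x \ae mu, Lrepr (Lscale a f) x = a * Lrepr f x.
Proof. by apply: filterS (LpiE _) => x E; exact: E. Qed.

Let LzeroE : \forall x \ae mu, Lrepr Lzero x = 0.
Proof. by apply: filterS (LpiE _) => x E; exact: E. Qed.

Let LaddA : associative Ladd.
Proof.
move=> f g h; apply: Lspace_aeP; near=> x => _.
rewrite (near (LaddE f (Ladd g h)))// (near (LaddE g h))//.
by rewrite (near (LaddE (Ladd f g) h))// (near (LaddE f g))// addrA.
Unshelve. all: by end_near. Qed.

Let LaddC : commutative Ladd.
Proof.
move=> f g; apply: Lspace_aeP; near=> x => _.
by rewrite (near (LaddE f g))// (near (LaddE g f))// addrC.
Unshelve. all: by end_near. Qed.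

Let Ladd0 : left_id Lzero Ladd.
Proof.
move=> f; apply: Lspace_aeP; near=> x => _.
by rewrite (near (LaddE Lzero f))// (near LzeroE)// add0r.
Unshelve. all: by end_near. Qed.

Let LaddN : left_inverse Lzero Lopp Ladd.
Proof.
move=> f; apply: Lspace_aeP; near=> x => _.
rewrite (near (LaddE (Lopp f) f))// (near (LoppE f))// (near LzeroE)//.
by rewrite addNr.
Unshelve. all: by end_near. Qed.

HB.instance Definition _ := GRing.isZmodule.Build L LaddA LaddC Ladd0 LaddN.

Let LscaleA : forall a b f, Lscale a (Lscale b f) = Lscale (a * b) f.
Proof.
move=> a b f; apply: Lspace_aeP; near=> x => _.
rewrite (near (LscaleE a (Lscale b f)))// (near (LscaleE b f))//.
by rewrite (near (LscaleE (a * b) f))// mulrA.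
Unshelve. all: by end_near. Qed.

Let Lscale1 : left_id 1 Lscale.
Proof.
move=> f; apply: Lspace_aeP; near=> x => _.
by rewrite (near (LscaleE 1 f))// mul1r.
Unshelve. all: by end_near. Qed.

Let LscaleDr : right_distributive Lscale +%R.
Proof.
move=> a f g; apply: Lspace_aeP; near=> x => _.
rewrite (near (LscaleE a (Ladd f g)))// (near (LaddE f g))//.
rewrite (near (LaddE (Lscale a f) (Lscale a g)))// (near (LscaleE a f))//.
by rewrite (near (LscaleE a g))// mulrDr.
Unshelve. all: by end_near. Qed.

Let LscaleDl : forall f, {morph Lscale^~ f : a b / a + b}.
Proof.
move=> f a b; apply: Lspace_aeP; near=> x => _.
rewrite (near (LscaleE (a + b) f))//.
rewrite (near (LaddE (Lscale a f) (Lscale b f)))// (near (LscaleE a f))//.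
by rewrite (near (LscaleE b f))// mulrDl.
Unshelve. all: by end_near. Qed.

HB.instance Definition _ :=
  GRing.Zmodule_isLmodule.Build R L LscaleA Lscale1 LscaleDr LscaleDl.

Definition Lspace_norm (f : L) : R := fine 'N[mu]_p[EFin \o Lrepr f].

Let Lspace_normE (f : L) (g : LfunType mu p1) :
  Lrepr f = g %[ae mu] -> Lspace_norm f = fine 'N[mu]_p[EFin \o g].
Proof. by move=> fg; congr fine; exact: ae_Lnorm. Qed.

Let Lspace_normD f g : Lspace_norm (f + g) <= Lspace_norm f + Lspace_norm g.
Proof. by rewrite (Lspace_normE (LpiE _)); exact: ler_LnormD. Qed.

Let Lspace_normZ a f : Lspace_norm (a *: f) = `|a| * Lspace_norm f.
Proof.
rewrite (Lspace_normE (LpiE _)) /Lspace_norm.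
by rewrite [X in fine X](LnormZ (Lrepr f) a) fineM// -finite_norm_fine.
Qed.

Let Lspace_norm_eq0 f : Lspace_norm f = 0 -> f = 0.
Proof.
move=> /fine_Lnormr_eq0 f0; apply: Lspace_aeP.
by near=> x => _; rewrite (near f0)// (near LzeroE).
Unshelve. all: by end_near. Qed.

HB.instance Definition _ := Lmodule_isNormed.Build R L
  Lspace_normD Lspace_normZ Lspace_norm_eq0.

End Lspace.

(* Functions on the whole line modulo equality almost everywhere on ]0, 1[. *)
Definition lebesgue01 (R : realType) : {measure set (measurableTypeR R) -> \bar R} :=
  mrestr (@lebesgue_measure R) (measurable_itv `]0, 1[%R).

Definition L1_01 (R : realType) : normedModType R :=
  LspaceType (lebesgue01 R) (lexx 1%E).

Section Banach_notions.
Context {R : realType}.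
Implicit Types (X Y : normedModType R).

(* The precise meaning of identifying a normed space X with a normed space Y. *)
Definition isometrically_isomorphic X Y :=
  exists2 f : {linear X -> Y}, forall x, `|f x| = `|x| & bijective f.

Lemma le_dual_norm X (f : dual X) (x : X) : `|f x| <= `|f| * `|x|.
Proof.
have := dual_funP f; rewrite inE => -[lf _].
pose g : {linear X -> R^o} := HB.pack (f : X -> R^o)
  (GRing.isLinear.Build R X R^o *:%R f lf).
have [->|x0] := eqVneq x 0.
  by rewrite [f 0](linear0 g) !normr0 mulr0.
have : `|f (`|x|^-1 *: x)| <= `|f|.
  apply: (le_supnorm (dual_bounded f)) => /=.
  by rewrite normrZ normfV normr_id mulVf ?normr_eq0.
rewrite [f _](linearZ_LR g) normrM normfV normr_id.
by rewrite ler_pdivrMl ?normr_gt0// mulrC.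
Qed.

Definition evaluation X (x : X) (f : dual X) : R^o := f x.

Lemma evaluation_dual X (x : X) : evaluation x \in @dual_pred R (dual X).
Proof.
have le : linear (evaluation x) by [].
rewrite inE; split => //.
pose g : {linear (dual X) -> R^o} := HB.pack (evaluation x)
  (GRing.isLinear.Build R (dual X) R^o *:%R (evaluation x) le).
apply: (@bounded_linear_continuous _ _ _ g); apply/linear_boundedP.
by near=> r => f; rewrite (le_trans (le_dual_norm f x))// mulrC ler_wpM2r.
Unshelve. all: by end_near. Qed.

Definition bidual_embedding X (x : X) : dual (dual X) :=
  Dual (evaluation_dual x).

Definition reflexive_space X := forall F : dual (dual X),
  exists x : X, bidual_embedding x = F.

Definition separable (T : topologicalType) :=
  exists2 D : set T, countable D & dense D.

Definition asplund (Y : completeNormedModType R) :=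
  forall M : submodClosed Y,
    separable (subspace_of M) -> separable (dual (subspace_of M)).

(* Only the restriction of T to S is relevant. *)
Definition step_isometry X (S : set X) (T : X -> X) :=
  set_bij S S T /\
  forall x y, S x -> S y -> Num.floor `|x - y| = Num.floor `|T x - T y|.

End Banach_notions.

(* Main.v *)
(** If [z] tends to [x] in [S] and [w] is in [S] with [|w - T x| < k], [k] an
    integer, then eventually [|w - T z| < k].  Hence [u = (T z - T x) / 2] is
    eventually such that translation by [u] keeps any given point of an open
    ball of radius [M > 1] centred at 0 in that ball.  Applied to [v] and [- v],
    this gives [|v + u|, |v - u| <= |v| + e], and continuity of [T] amounts to
    [u] tending to 0.

    In [C(K)] and [C_b(K)] take [v = 1].  In [L_1(0,1)] take for [v] multiples
    of the indicators of the two halves of the interval: a disjoint perturbation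
    adds its whole norm.

    In a dual [Y^*], if [u] does not tend to 0, choose inductively [u_n] of norm
    at least [e] all of whose finite subset sums have norm less than 2, together
    with [y_n] in the unit ball of [Y] almost norming [u_n], such that [u_j(y_n)]
    is tiny for [j > n].  The weak-* sums [u_A], [A] a subset of [nat], are then
    uniformly separated on the [y_n], because at the first [n] where [A] and [B]
    differ only the terms [j >= n] matter.  If [Y] is Asplund this contradicts
    the separability of the dual of the span of the [y_n]; if [Y^*] is reflexive
    all [u_A] lie in the closed span of the [u_n], which is separable.

    A separable dual [Y^*] is the dual of an Asplund space, namely the completion
    of [Y]: the restriction of functionals to a subspace is onto and contracting. *)

Require Import Defs.
From HB Require Import structures.
From mathcomp Require Import all_boot all_order all_algebra.
From mathcomp Require Import all_classical all_reals all_analysis.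
From mathcomp Require Import measurable_realfun lra ring.

Set Implicit Arguments.
Unset Strict Implicit.
Unset Printing Implicit Defensive.
Import Order.TTheory GRing.Theory Num.Theory.
Import numFieldNormedType.Exports.
Local Open Scope classical_set_scope.
Local Open Scope ring_scope.

(** * Hahn-Banach *)

Section hahn_banach.
Context {R : realType} {V : lmodType R}.
Implicit Types (p q : V -> R) (x y : V) (G : set (V * R)).

Lemma linear_opp (f : V -> R^o) x : linear f -> f (- x) = - f x.
Proof.
move=> lf.
pose g : {linear V -> R^o} := HB.pack f (GRing.isLinear.Build R V R^o *:%R f lf).
exact: (linearN g).
Qed.

Definition sublinear p :=
  (forall x y, p (x + y) <= p x + p y) /\
  (forall (a : R) x, 0 <= a -> p (a *: x) = a * p x).

Definition cone G :=
  [/\ G (0, 0), (forall x y r s, G (x, r) -> G (y, s) -> G (x + y, r + s)) &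
      forall (a : R) x r, 0 <= a -> G (x, r) -> G (a *: x, a * r)].

Lemma sublinear0 p : sublinear p -> p 0 = 0.
Proof. by move=> [_ pZ]; rewrite -(scale0r 0) pZ// mul0r. Qed.

Lemma sublinear_ge p x y : sublinear p -> p y - p (- x) <= p (x + y).
Proof.
move=> [pD _]; rewrite lerBlDr; apply: le_trans (pD _ _).
by rewrite addrAC subrr add0r.
Qed.

(** The reverse inequality is the given one for [a^-1] at [a *: x]. *)
Lemma sublinear_of_le p : (forall x y, p (x + y) <= p x + p y) ->
  (forall (a : R) x, 0 < a -> p (a *: x) <= a * p x) -> p 0 = 0 -> sublinear p.
Proof.
move=> pD pZ p0; split=> // a x; rewrite le_eqVlt => /predU1P[<-|a0].
  by rewrite scale0r p0 mul0r.
apply/eqP; rewrite eq_le pZ//=.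
rewrite -[in leLHS](scalerK (lt0r_neq0 a0) x) -ler_pdivlMl//.
by apply: pZ; rewrite invr_gt0.
Qed.

(* The value at [x] is the best bound that [p] and the constraints [r <= f c],
   [(c, r)] in [G], impose on [f x] for a linear functional [f <= p]. *)
Definition cone_inf p G x := inf [set p (x + c.1) - c.2 | c in G].

Section cone_inf.
Variables (p : V -> R) (G : set (V * R)).
Hypotheses (ps : sublinear p) (cG : cone G).
Hypothesis Gp : forall x r, G (x, r) -> r <= p x.

Let q := cone_inf p G.

Lemma cone_inf_le x c r : G (c, r) -> q x <= p (x + c) - r.
Proof.
move=> Gc; apply: ge_inf; last by exists (c, r).
(* This lower bound makes the infimum genuine: [s <= p d <= p (x + d) + p (- x)] for each constraint
   [(d, s)]. *)
exists (- p (- x)) => _ [[d s] Gd <-] /=.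
rewrite lerBrDr addrC (le_trans _ (sublinear_ge x d ps))// lerD2r.
exact: Gp.
Qed.

Lemma le_cone_inf x (y : R) :
  (forall c r, G (c, r) -> y <= p (x + c) - r) -> y <= q x.
Proof.
move=> H; apply: lb_le_inf => [|_ [[c r] Gc <-]]; last exact: H.
by exists (p (x + 0) - 0), (0, 0) => //; case: cG.
Qed.

Lemma cone_inf_le_self x : q x <= p x.
Proof. by have [G0 _ _] := cG; have := cone_inf_le x G0; rewrite addr0 subr0. Qed.

(** As [G] is a cone, constraints used for [x] and for [y] add up to one usable for [x + y], and
    they scale along with the vector. *)
Lemma cone_inf_sublinear : sublinear q.
Proof.
have [G0 GD GZ] := cG; have [pD pZ] := ps.
apply: sublinear_of_le => [x y|a x a0|].
- rewrite -lerBlDr; apply: le_cone_inf => c r Gc.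
  rewrite lerBlDr -lerBlDl; apply: le_cone_inf => d s Gd.
  rewrite lerBlDl (le_trans (cone_inf_le _ (GD _ _ _ _ Gc Gd)))//.
  rewrite addrACA -[leRHS]addrACA -opprD lerD2r; exact: pD.
- rewrite -ler_pdivrMl//; apply: le_cone_inf => c r Gc.
  rewrite ler_pdivrMl// (le_trans (cone_inf_le _ (GZ _ _ _ (ltW a0) Gc)))//.
  by rewrite -scalerDr pZ ?(ltW a0)// mulrBr.
- apply/eqP; rewrite eq_le -{1}(sublinear0 ps) cone_inf_le_self/=.
  by apply: le_cone_inf => c r /Gp; rewrite add0r subr_ge0.
Qed.

End cone_inf.

(** Zorn's lemma on the sublinear functionals below [p]: all of them are at least [- p (- x)] at
    [x], so a nonempty chain has a pointwise infimum. *)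
Lemma minimal_sublinear p : sublinear p ->
  exists q, [/\ sublinear q, (forall x, q x <= p x) &
    forall q', sublinear q' -> (forall x, q' x <= q x) -> q' = q].
Proof.
move=> ps; pose T := {q : V -> R | sublinear q /\ forall x, q x <= p x}.
have qlb (q : T) x : - p (- x) <= sval q x.
  case: q => q [qs qp] /=; rewrite lerNl.
  apply: le_trans (qp _); rewrite -sub0r -(sublinear0 qs) -(subrr x).
  by rewrite lerBlDr addrC; case: qs => + _; apply.
(* The order is reversed, so that maximal means minimal. *)
pose le (q r : T) := `[< forall x, sval r x <= sval q x >].
have [| | | |[q [qs qp]] qmin] := @Zorn T le.
- by move=> q; apply/asboolP.
- move=> r q s /asboolP qr /asboolP rs; apply/asboolP => x.
  exact: le_trans (rs x) (qr x).
- move=> q r /asboolP qr /asboolP rq; apply: eq_sig_hprop => [s|].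
    exact: Prop_irrelevance.
  by apply/funext => x; apply/eqP; rewrite eq_le qr rq.
- move=> A Atot; have [A0|/set0P[q0 Aq0]] := eqVneq A set0.
    by exists (exist _ p (conj ps (fun x => lexx _))) => s; rewrite A0.
  pose q x := inf [set sval r x | r in A].
  have q_le r x : A r -> q x <= sval r x.
    move=> Ar; apply: ge_inf; last by exists r.
    by exists (- p (- x)) => _ [s _ <-]; exact: qlb.
  have le_q x (y : R) : (forall r, A r -> y <= sval r x) -> y <= q x.
    move=> H; apply: lb_le_inf => [|_ [r Ar <-]]; last exact: H.
    by exists (sval q0 x); exists q0.
  have qs : sublinear q.
    apply: sublinear_of_le => [x y|a x a0|].
    + rewrite -lerBlDr; apply: (le_q) => r Ar.
      rewrite lerBlDr -lerBlDl; apply: (le_q) => s As.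
      (* In a chain one of [r], [s] lies below the other, and it alone serves for both [x] and
         [y]. *)
      rewrite lerBlDl; have [/asboolP rs|/asboolP sr] := Atot _ _ Ar As.
        rewrite (le_trans (q_le _ _ As))//; case: (svalP s) => -[sD _] _.
        by rewrite (le_trans (sD _ _))// lerD2r; exact: rs.
      rewrite (le_trans (q_le _ _ Ar))//; case: (svalP r) => -[rD _] _.
      by rewrite (le_trans (rD _ _))// lerD2l; exact: sr.
    + rewrite -ler_pdivrMl//; apply: (le_q) => r Ar; rewrite ler_pdivrMl//.
      by rewrite (le_trans (q_le _ _ Ar))//; case: (svalP r) => -[_ ->]//; exact: ltW.
    + apply/eqP; rewrite eq_le; apply/andP; split.
        rewrite (le_trans (q_le _ _ Aq0))//.
        by case: (svalP q0) => /sublinear0 ->.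
      by apply: (le_q) => r _; case: (svalP r) => /sublinear0 ->.
  have qp x : q x <= p x.
    by rewrite (le_trans (q_le _ _ Aq0))//; case: (svalP q0).
  by exists (exist _ q (conj qs qp)) => s As; apply/asboolP => x; exact: q_le.
- exists q; split => // q' q's q'q.
  have q'p x : q' x <= p x by exact: le_trans (q'q x) (qp x).
  by have /(congr1 sval) := qmin (exist _ q' (conj q's q'p)) (asboolT q'q).
Qed.

(** A minimal sublinear [q] is linear: imposing the ray through [(y, q y)] as constraints cannot
    lower it, whence [q x <= q (x + y) - q y]. *)
Lemma sublinear_ge_linear p : sublinear p ->
  exists f : V -> R^o, linear f /\ forall x, f x <= p x.
Proof.
move=> /minimal_sublinear[q [qs qp qmin]]; exists q; split => //.
have [qD qZ] := qs.
have qDE x y : q (x + y) = q x + q y.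
  apply/eqP; rewrite eq_le qD/=.
  pose G := [set (t *: y, t * q y) | t in [set t : R | 0 <= t]].
  have cG : cone G.
    split; first by exists 0; rewrite /= ?lexx// scale0r mul0r.
      move=> _ _ _ _ [a a0 [<- <-]] [b b0 [<- <-]]; exists (a + b).
        by rewrite /= addr_ge0.
      by rewrite scalerDl mulrDl.
    move=> c _ _ c0 [a a0 [<- <-]]; exists (c * a); first by rewrite /= mulr_ge0.
    by rewrite scalerA mulrA.
  have Gq z r : G (z, r) -> r <= q z by move=> [a a0 [<- <-]]; rewrite qZ.
  have E := qmin _ (cone_inf_sublinear qs cG Gq) (cone_inf_le_self qs cG Gq).
  rewrite -lerBrDr -{1}E; apply: cone_inf_le => //.
  by exists 1; rewrite /= ?scale1r ?mul1r.
have qN x : q (- x) = - q x.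
  by apply/eqP; rewrite -addr_eq0 -qDE addNr sublinear0.
move=> a x y; rewrite qDE; congr (_ + _).
have [a0|a0] := leP 0 a; first exact: qZ.
have := qZ (- a) x; rewrite oppr_ge0 (ltW a0) scaleNr qN mulNr => /(_ isT).
exact: oppr_inj.
Qed.

(** A linear functional below [cone_inf p G] obeys each constraint, as
    [f (- x) <= p (- x + x) - r = - r]. Extension from a subspace and separation from one are both
    instances, for suitable cones. *)
Lemma cone_extension p G : sublinear p -> cone G ->
  (forall x r, G (x, r) -> r <= p x) ->
  exists f : V -> R^o, [/\ linear f, (forall x, f x <= p x) &
    forall x r, G (x, r) -> r <= f x].
Proof.
move=> ps cG Gp; have [f [lf fq]] := sublinear_ge_linear (cone_inf_sublinear ps cG Gp).
exists f; split => // [x|x r Gx].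
  exact: le_trans (fq x) (cone_inf_le_self ps cG Gp x).
rewrite -lerN2 -linear_opp// (le_trans (fq _))// (le_trans (cone_inf_le ps Gp _ Gx))//.
by rewrite addNr sublinear0// sub0r.
Qed.

Lemma seminorm_support p x :
  (forall x y, p (x + y) <= p x + p y) ->
  (forall (a : R) x, p (a *: x) = `|a| * p x) ->
  exists f : V -> R^o, [/\ linear f, (forall y, `|f y| <= p y) & f x = p x].
Proof.
move=> pD pZ.
have pN y : p (- y) = p y by rewrite -scaleN1r pZ normrN1 mul1r.
have ps : sublinear p by split => // a y a0; rewrite pZ ger0_norm.
have p0 y : 0 <= p y.
  have := pD y (- y); rewrite subrr sublinear0// pN => H; lra.
pose G := range (fun t : R => (t *: x, t * p x)).
have cG : cone G.
  split; first by exists 0; rewrite // scale0r mul0r.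
    move=> _ _ _ _ [a _ [<- <-]] [b _ [<- <-]]; exists (a + b) => //.
    by rewrite scalerDl mulrDl.
  by move=> c _ _ c0 [a a0 [<- <-]]; exists (c * a); rewrite ?scalerA ?mulrA.
have [|f [lf fp Gf]] := @cone_extension _ _ ps cG.
  by move=> _ _ [a _ [<- <-]]; rewrite pZ ler_wpM2r ?ler_norm.
exists f; split => // [y|].
  rewrite ler_norml fp andbT lerNl -pN; apply: le_trans (fp _).
  by rewrite linear_opp.
apply/eqP; rewrite eq_le fp/=; apply: Gf.
by exists 1; rewrite ?scale1r ?mul1r.
Qed.

End hahn_banach.

(** * Step isometries and vanishing filters *)

Section vanishing.
Context {R : realType}.
Implicit Type X : normedModType R.

(* The information that a step isometry preserves about [T z - T x] as [z] tends
   to [x]. *)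
Definition vanishing X (F : set_system X) :=
  forall v M, 1 < M -> `|v| < M -> \forall u \near F, `|v + u| < M.

(** Stated for filters, so as to apply to the image of the neighbourhoods of a point under
    [z |-> (T z - T x) / 2]. *)
Definition rigid X :=
  forall F : set_system X, ProperFilter F -> vanishing F -> F --> (0 : X).

Lemma dense_approx X (S : set X) (x : X) (e : R) : dense S -> 0 < e ->
  exists2 y, S y & `|x - y| < e.
Proof.
move=> dS e0; have [|y [xy Sy]] := dS (ball x e) _ (ball_open_nbhs x e0).1.
  by exists x; exact: ballxx.
by exists y => //; move: xy; rewrite -ball_normE.
Qed.

Lemma step_isometry_lt X (S : set X) (T : X -> X) (x y : X) (k : int) :
  step_isometry S T -> S x -> S y ->
  (`|x - y| < k%:~R) = (`|T x - T y| < k%:~R).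
Proof. by move=> [_ TS] Sx Sy; rewrite -!floor_lt_int TS. Qed.

(* Scaling [v] up to an integer radius makes the condition [`|v| < M]
   accessible to a step isometry; undoing the scaling costs the factor 1/2. *)
Lemma step_isometry_vanishing X (S : set X) (T : X -> X) (x : X) :
  dense S -> step_isometry S T -> S x ->
  vanishing ((fun z => 2^-1 *: (T z - T x)) @ within S (nbhs x)).
Proof.
move=> dS iT Sx v M M1 vM.
have [[TS _ surT] _] := iT.
(* Since [m >= 1], the integer [K] below satisfies [K <= N + 1 < 2 N], so the scaling factor [l]
   lies between 1 and 2. *)
pose m := Num.max 1 `|v|.
have mM : m < M by rewrite gt_max M1.
have m1 : 1 <= m by rewrite le_max lexx.
have vm : `|v| <= m by rewrite le_max lexx orbT.
pose N := (m + M) / 2.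
have mN : m < N by rewrite /N; lra.
have NM : N < M by rewrite /N; lra.
pose k : int := Num.floor N + 1.
have Nk : N < k%:~R by exact: floorD1_gt.
have kN : k%:~R - 1 <= N by rewrite /k intrD addrK floor_le.
set K : R := k%:~R in kN Nk.
pose l := K / N.
have N0 : 0 < N by lra.
have l1 : 1 <= l by rewrite /l ler_pdivlMr// mul1r ltW.
have l2 : l <= 2 by rewrite /l ler_pdivrMr//; lra.
have lvK : `|l *: v| < K.
  rewrite normrZ ger0_norm ?(le_trans _ l1)// /l mulrAC ltr_pdivrMr//.
  by rewrite ltr_pM2l ?(le_lt_trans vm)// (lt_trans _ Nk).
(* The first term keeps [T p] within [K] of [T x]; the second lets the error be absorbed in passing
   from radius [N] to [M]. *)
pose e := Num.min (K - `|l *: v|) (M - N).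
have e0 : 0 < e by rewrite lt_min !subr_gt0 lvK.
(* [w] replaces [T x - l *: v], which need not be in [S]. Its preimage [p] is within [K] of [x],
   hence of all nearby [z], and applying [T] again bounds [w - T z]. *)
have [w Sw we] := dense_approx (T x - l *: v) dS e0.
have [p Sp Tp] := surT _ Sw.
have pxK : `|p - x| < K.
  rewrite (step_isometry_lt _ iT)// Tp distrC.
  rewrite (_ : T x - w = l *: v + (T x - l *: v - w)); last first.
    by rewrite [RHS]addrC addrAC subrK.
  rewrite (le_lt_trans (ler_normD _ _))//.
  by rewrite -ltrBrDl (lt_le_trans we)// ge_min lexx.
rewrite near_map near_withinE /=.
have : \forall z \near x, `|p - z| < K.
  apply: (@cvgr_norm_lt _ _ _ (nbhs x) _ (fun z => p - z) (p - x)) => //.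
  by apply: cvgB; [exact: cvg_cst|exact: cvg_id].
apply: filterS => z; move=> pzK Sz.
have dK : `|l *: v + (T z - T x)| < K + e.
  rewrite -[X in X < _]normrN.
  rewrite (_ : - (l *: v + (T z - T x)) = (w - T z) + (T x - l *: v - w)); last first.
    by rewrite opprD opprB addrCA addrA [RHS]addrC addrA subrK.
  rewrite (le_lt_trans (ler_normD _ _))// ltrD//.
  by move: pzK; rewrite (step_isometry_lt _ iT)// Tp.
have l0 : 0 < l by lra.
have lN : `|v + l^-1 *: (T z - T x)| < M.
  rewrite -(ltr_pM2l l0) -[X in X * `|_|](ger0_norm (ltW l0)) -normrZ.
  rewrite scalerDr scalerKV ?gt_eqF// (lt_le_trans dK)//.
  have eM : e <= M - N by rewrite /e ge_min lexx orbT.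
  have lNK : l * N = K by rewrite /l mulfVK// gt_eqF.
  have : 0 <= (l - 1) * (M - N) by rewrite mulr_ge0; lra.
  lra.
(* A convex combination, as [l / 2 <= 1], of two vectors of norm below [M]. *)
have -> : v + 2^-1 *: (T z - T x) =
    (1 - l / 2) *: v + (l / 2) *: (v + l^-1 *: (T z - T x)).
  rewrite [in RHS]scalerDr [RHS]addrA -scalerDl subrK scale1r scalerA.
  by rewrite mulrAC mulfV ?mul1r ?gt_eqF.
have lA : 0 <= 1 - l / 2 by lra.
have lB : 0 < l / 2 by lra.
rewrite (le_lt_trans (ler_normD _ _))// normrZ (ger0_norm lA) normrZ (gtr0_norm lB).
have : (1 - l / 2) * `|v| <= (1 - l / 2) * m by rewrite ler_wpM2l.
have : (l / 2) * `|v + l^-1 *: (T z - T x)| < (l / 2) * M.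
  by rewrite ltr_pM2l.
have : (1 - l / 2) * m <= (1 - l / 2) * M by apply: ler_wpM2l => //; exact: ltW.
lra.
Qed.

Lemma rigid_continuous X (S : set X) (T : X -> X) :
  rigid X -> dense S -> step_isometry S T -> {within S, continuous T}.
Proof.
move=> rX dS iT; apply/subspace_continuousP => x Sx.
have FF : ProperFilter ((fun z => 2^-1 *: (T z - T x)) @ within S (nbhs x)).
  apply: fmap_proper_filter; apply: Build_ProperFilter_ex => U Ux.
  by exists x; have := nbhs_singleton Ux; rewrite /within/= => /(_ Sx).
have := rX _ FF (step_isometry_vanishing dS iT Sx).
move=> /cvgr0Pnorm_lt T0; apply/cvgrPdist_lt => e e0.
have := T0 (e / 2) (divr_gt0 e0 (ltr0Sn _ _)); apply: filterS => z.
rewrite normrZ gtr0_norm ?invr_gt0// mulrC ltr_pM2r ?invr_gt0//.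
by rewrite distrC.
Qed.

Lemma rigid_iso X (Y : normedModType R) :
  isometrically_isomorphic X Y -> rigid Y -> rigid X.
Proof.
move=> [f fn [g fK gK]] rY F FF vF.
have vfF : vanishing (f @ F).
  move=> v M M1 vM; rewrite near_map.
  have : \forall u \near F, `|g v + u| < M by apply: vF => //; rewrite -fn gK.
  by apply: filterS => u; rewrite -fn linearD gK.
have /cvgr0Pnorm_lt F0 : f @ F --> (0 : Y) by exact: rY.
apply/cvgr0Pnorm_lt => e e0; have := F0 _ e0.
by apply: filterS => u; rewrite fn.
Qed.

(** [vanishing] is applied to the four test vectors with radii [|v| + d] and [|w| + d]; norms at
    least 1 keep these radii above 1. *)
Lemma rigid_of_support X (v w : X) (C : R) : 0 < C -> 1 <= `|v| -> 1 <= `|w| ->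
  (forall u (e : R), 0 <= e ->
    `|v + u| <= `|v| + e -> `|- v + u| <= `|v| + e ->
    `|w + u| <= `|w| + e -> `|- w + u| <= `|w| + e -> `|u| <= C * e) ->
  rigid X.
Proof.
move=> C0 v1 w1 H F FF vF; apply/cvgr0Pnorm_lt => e e0.
pose d := e / C / 2.
have d0 : 0 < d by rewrite !divr_gt0.
have near_le z : 1 <= `|z| -> \forall u \near F,
    `|z + u| <= `|z| + d /\ `|- z + u| <= `|z| + d.
  move=> z1; have zd : `|z| < `|z| + d by lra.
  have : \forall u \near F, `|z + u| < `|z| + d by apply: vF => //; lra.
  have : \forall u \near F, `|- z + u| < `|z| + d.
    by apply: vF; rewrite ?normrN//; lra.
  by apply: filterS2 => u /ltW + /ltW.
have := near_le _ v1; have := near_le _ w1; apply: filterS2 => u [? ?] [? ?].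
rewrite (le_lt_trans (H u d (ltW d0) _ _ _ _))//.
have -> : C * d = e / 2 by rewrite /d; field; rewrite gt_eqF.
by rewrite ltr_pdivrMr//; lra.
Qed.

End vanishing.

(** * Spaces with a supremum norm *)

(** Common to [C(K)] and [C_b(K)]: at each [t], both [1 + u t] and [-1 + u t] have absolute value at
    most [1 + e], so [|u t| <= e]. *)
Lemma rigid_supnorm (R : realType) (X : normedModType R) (K : Type)
    (ev : X -> K -> R^o) (one : X) :
  (forall x, bounded_over setT (ev x)) -> (forall x, `|x| = supnorm setT (ev x)) ->
  (forall x y t, ev (x + y) t = ev x t + ev y t) -> (forall t, ev one t = 1) ->
  rigid X.
Proof.
move=> bev evn evD ev1.
have ev0 t : ev 0 t = 0 by have := evD 0 0 t; rewrite addr0 => ?; lra.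
have evN x t : ev (- x) t = - ev x t.
  by have := evD x (- x) t; rewrite subrr ev0 => ?; lra.
have evle x t : `|ev x t| <= `|x| by rewrite evn; exact: le_supnorm.
(* On an empty [K] the vector [one] has norm 0 instead of 1, but so has every vector. *)
have [[t0]|K0] := pselect (inhabited K); last first.
  move=> F FF _; apply/cvgr0Pnorm_lt => e e0; near=> u.
  rewrite evn (le_lt_trans _ e0)//; apply: supnorm_le => // t.
  by case: K0; exists.
have one1 : `|one| = 1.
  apply/eqP; rewrite eq_le; apply/andP; split.
    by rewrite evn; apply: supnorm_le => // t _; rewrite ev1 normr1.
  by rewrite -{1}(normr1 R) -(ev1 t0); exact: evle.
apply: (@rigid_of_support _ _ one one 1); rewrite ?one1// => u e e0 up um _ _.
rewrite mul1r evn; apply: supnorm_le => // t _.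
have := le_trans (evle (one + u) t) up; have := le_trans (evle (- one + u) t) um.
rewrite !evD evN !ev1 !ler_norml => /andP[? ?] /andP[? ?]; apply/andP; split; lra.
Unshelve. all: by end_near. Qed.

Lemma rigid_Cb (R : realType) (K : topologicalType) : rigid (Cb R K).
Proof.
have c1 : (cst 1 : K -> R^o) \in @Cb_pred R K.
  rewrite inE; split; first exact: cst_continuous.
  by exists 1 => t _; rewrite normr1.
apply: (@rigid_supnorm R (Cb R K) K (@Cb_fun R K) (MkCb c1)) => // x.
exact: Cb_bounded.
Qed.

Lemma rigid_C (R : realType) (K : topologicalType) (cK : compact [set: K]) :
  rigid (C R cK).
Proof.
have c1 : (cst 1 : K -> R^o) \in @C_pred R K.
  by rewrite inE; exact: cst_continuous.
apply: (@rigid_supnorm R (C R cK) K (@C_fun R K cK) (MkC cK c1)) => // x.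
exact: C_bounded.
Qed.

(** * L1 *)

Section L1.
Context d (T : measurableType d) (R : realType).
Variables (mu : {measure set T -> \bar R}) (p1 : (1 <= 1%:E :> \bar R)%E).
Local Notation L := (LspaceType mu p1).
Implicit Types f g : L.

Lemma L1_normE f : (`|f|%:E = \int[mu]_x `|(Lrepr f : T -> R) x|%:E)%E.
Proof.
rewrite [`|f|]/(fine 'N[mu]_1[EFin \o Lrepr f]%E) fineK; first by rewrite Lnorm1.
rewrite ge0_fin_numE ?Lnorm_ge0//.
exact: Lfunction_finite.
Qed.

(** Integration reduces an inequality between sums of norms to one between real numbers. *)
Lemma L1_sum_norm_le (s t : seq L) :
  (\forall x \ae mu, \sum_(f <- s) `|(Lrepr f : T -> R) x| <=
                     \sum_(f <- t) `|(Lrepr f : T -> R) x|) ->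
  \sum_(f <- s) `|f| <= \sum_(f <- t) `|f|.
Proof.
move=> st.
pose a (f : L) (x : T) : R := `|(Lrepr f : T -> R) x|.
have ma f : measurable_fun setT (a f).
  by apply: measurableT_comp => //; exact: Lspace_measurable.
have nE (r : seq L) : ((\sum_(f <- r) `|f|)%:E =
    \int[mu]_x (\sum_(f <- r) a f x)%:E)%E.
  under eq_integral do rewrite -sumEFin.
  rewrite ge0_integral_sum//.
  - by rewrite -sumEFin; apply: eq_bigr => f _; exact: L1_normE.
  - by move=> f; exact/measurable_EFinP.
  - by move=> f x _; rewrite lee_fin normr_ge0.
have ms (r : seq L) : measurable_fun setT (fun x => (\sum_(f <- r) a f x)%:E : \bar R).
  by apply/measurable_EFinP; apply: measurable_sum.
have n0 (r : seq L) x : 0 <= \sum_(f <- r) a f x 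
  by apply: sumr_ge0 => f _; exact: normr_ge0.
rewrite -lee_fin !nE; apply: ae_ge0_le_integral => //.
- by move=> x _; rewrite lee_fin.
- by move=> x _; rewrite lee_fin.
- by apply: filterS st => x sx _; rewrite lee_fin.
Qed.

Lemma L1_indic (A : set T) (c : R) : measurable A -> (mu setT < +oo)%E -> 0 <= c ->
  exists2 f : L, (Lrepr f : T -> R) = (fun x => c * \1_A x) %[ae mu] &
    (`|f|%:E = c%:E * mu A)%E.
Proof.
move=> mA fmu c0.
have H : (fun x => c * \1_A x) \in Lfun mu 1%:E.
  apply/Lfun1_integrable; apply/integrableP; split.
    apply/measurable_EFinP; apply: measurable_funM => //.
  under eq_integral.
    by move=> x _; rewrite /= ger0_norm ?mulr_ge0//; over.
  rewrite (integralZl_indic _ (fun=> A))//; last by rewrite ltNge c0.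
  rewrite integral_indic// setIT.
  rewrite lte_mul_pinfty// (le_lt_trans _ fmu)//; apply: le_measure; rewrite ?inE//.
pose h : LfunType mu p1 := Lfun_Sub p1 H.
exists (Lpi h); first exact: LpiE.
rewrite L1_normE.
transitivity (\int[mu]_x (c * \1_A x)%:E)%E.
  apply: ae_eq_integral => //.
  - apply/measurable_EFinP; apply: measurableT_comp => //; exact: Lspace_measurable.
  - by apply/measurable_EFinP; apply: measurable_funM.
  - apply: filterS (LpiE h) => x /(_ I) -> _ /=.
    by rewrite ger0_norm// mulr_ge0.
rewrite (integralZl_indic _ (fun=> A))//; last by rewrite ltNge c0.
by rewrite integral_indic// setIT.
Qed.

(** With [v] carried by [A] and [w] by its complement, one of them vanishes at almost every point,
    so that [2|v| + 2|w| + 2|u|] is at most the sum of the four perturbed absolute values there.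
    Integrated, this gives [2|u| <= 4 e], hence the constant 2. *)
Lemma rigid_L1 (A : set T) : measurable A -> (mu setT < +oo)%E ->
  (0 < mu A)%E -> (0 < mu (~` A))%E -> rigid L.
Proof.
move=> mA fmu A0 cA0.
have unit_indic B : measurable B -> (0 < mu B)%E -> exists f : L, 1 <= `|f| /\
    exists c, (Lrepr f : T -> R) = (fun x => c * \1_B x) %[ae mu].
  move=> mB B0.
  have fB : mu B \is a fin_num.
    rewrite ge0_fin_numE// (le_lt_trans _ fmu)//.
    by apply: le_measure; rewrite ?inE.
  have B0' : 0 < fine (mu B) by rewrite fine_gt0// B0 ltey_eq fB.
  have [|f fE fn] := @L1_indic B (fine (mu B))^-1 mB fmu.
    by rewrite invr_ge0 ltW.
  exists f; split; last by exists (fine (mu B))^-1.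
  rewrite -lee_fin fn -{2}(fineK fB) -EFinM mulVf// gt_eqF//.
have [v [v1 [a va]]] := unit_indic _ mA A0.
have [w [w1 [b wb]]] := unit_indic _ (measurableC mA) cA0.
apply: (@rigid_of_support _ _ v w 2) => // u e e0 h1 h2 h3 h4.
suff : \sum_(f <- [:: v; v; w; w; u; u]) `|f| <=
       \sum_(f <- [:: v + u; - v + u; w + u; - w + u]) `|f|.
  rewrite !big_cons !big_nil !addr0 => ?; lra.
have LD (f g : L) : \forall x \ae mu,
    (Lrepr (f + g) : T -> R) x = Lrepr f x + Lrepr g x.
  by apply: filterS (LpiE (Lrepr f + Lrepr g)) => x E; exact: E.
have LN (f : L) : \forall x \ae mu, (Lrepr (- f) : T -> R) x = - Lrepr f x.
  by apply: filterS (LpiE (- Lrepr f)) => x E; exact: E.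
apply: L1_sum_norm_le; near=> x; rewrite !big_cons !big_nil !addr0.
rewrite (near (LD v u) x)// (near (LD (- v) u) x)// (near (LN v) x)//.
rewrite (near (LD w u) x)// (near (LD (- w) u) x)// (near (LN w) x)//.
have := near va x _ I; have := near wb x _ I.
move: (Lrepr v x) (Lrepr w x) (Lrepr u x) => p q r -> // -> //.
have key (s t : R) : `|s| + `|s| <= `|s + t| + `|- s + t|.
  have := ler_normB (s + t) (- s + t).
  rewrite (_ : s + t - (- s + t) = s *+ 2) ?normrMn ?mulr2n//; ring.
rewrite !indicE in_setC; case: (x \in A); rewrite /= ?mulr1 ?mulr0 ?oppr0 ?add0r.
  have := key a r; rewrite normr0; lra.
have := key b r; rewrite normr0; lra.
Unshelve. all: by end_near. Qed.

End L1.

(** The halves are []0, 1/2[] and, within []0, 1[], its complement [[1/2, 1[]. *)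
Lemma rigid_L1_01 (R : realType) : rigid (L1_01 R).
Proof.
pose A : set (measurableTypeR R) := [set` Interval (BRight 0) (BLeft (2^-1))].
have mA : measurable A by exact: measurable_itv.
have A1 : lebesgue01 R A = (2^-1)%:E.
  rewrite /lebesgue01 /= /mrestr (_ : _ `&` _ = A); last first.
    apply/seteqP; split => x /=; first by case.
    rewrite /A /= !in_itv/= => /andP[x0 x1]; split; apply/andP; split => //; lra.
  rewrite /A lebesgue_measure_itv/= lte_fin invr_gt0 ltr0n/=.
  by rewrite -EFinB subr0.
have cA1 : lebesgue01 R (~` A) = (2^-1)%:E.
  rewrite /lebesgue01 /= /mrestr.
  rewrite (_ : _ `&` _ = [set` Interval (BLeft (2^-1)) (BLeft 1)]); last first.
    apply/seteqP; split => x /=; rewrite /A /= !in_itv/=.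
      by move=> [/negP H /andP[x0 x1]]; move: H; rewrite x0 x1/= andbT -leNgt.
    move=> /andP[x0 x1]; rewrite x1 andbT (lt_le_trans _ x0) ?invr_gt0//=.
    by split => //; apply/negP; rewrite -leNgt.
  rewrite lebesgue_measure_itv/= lte_fin ifT; last lra.
  by rewrite -EFinB; congr EFin; lra.
have T1 : lebesgue01 R setT = 1%E.
  rewrite /lebesgue01 /= /mrestr setTI.
  by rewrite lebesgue_measure_itv/= lte_fin ltr01 -EFinB subr0.
apply: (@rigid_L1 _ _ R (lebesgue01 R) _ _ mA).
- by rewrite T1 ltry.
- by rewrite A1 lte_fin invr_gt0.
- by rewrite cA1 lte_fin invr_gt0.
Qed.

(** * Dual spaces *)

Section dual_facts.
Context {R : realType} {Y : normedModType R}.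
Implicit Types (f g : dual Y) (y : Y).

Lemma dual_linear f : linear f.
Proof. by have := dual_funP f; rewrite inE => -[]. Qed.

HB.instance Definition _ f :=
  GRing.isLinear.Build R Y R^o *:%R (f : Y -> R^o) (dual_linear f).

Lemma dual_applyD f g y : (f + g) y = f y + g y. Proof. by []. Qed.

Lemma dual_apply_sum (I : Type) (r : seq I) (P : pred I) (f : I -> dual Y) y :
  (\sum_(i <- r | P i) f i) y = \sum_(i <- r | P i) f i y.
Proof.
exact: (big_morph (fun g : dual Y => g y) (fun f g => dual_applyD f g y)).
Qed.

Lemma bounded_linear_dual (f : Y -> R^o) (C : R) : linear f ->
  (forall y, `|f y| <= C * `|y|) -> f \in @dual_pred R Y.
Proof.
move=> lf fC; rewrite inE; split => //.
pose g : {linear Y -> R^o} := HB.pack f (GRing.isLinear.Build R Y R^o *:%R f lf).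
apply: (@bounded_linear_continuous _ _ _ g); apply/linear_boundedP.
near=> r => y; rewrite (le_trans (fC y))// ler_wpM2r//.
Unshelve. all: by end_near. Qed.

Lemma dual_norm_le f (C : R) : 0 <= C -> (forall y, `|f y| <= C * `|y|) -> `|f| <= C.
Proof.
move=> C0 fC; apply: supnorm_le => // y /= y1; rewrite (le_trans (fC y))//.
by rewrite -[leRHS]mulr1 ler_wpM2l.
Qed.

Lemma norming_functional y : exists2 f : dual Y, `|f| <= 1 & f y = `|y|.
Proof.
have [|f [lf fp fy]] := seminorm_support y (@ler_normD R Y).
  by move=> a x; exact: normrZ.
have Hf : f \in @dual_pred R Y.
  by apply: (@bounded_linear_dual f 1) => // x; rewrite mul1r.
exists (Dual Hf) => //; apply: dual_norm_le => // x; rewrite mul1r; exact: fp.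
Qed.

(** The norm is a supremum that may not be attained, hence the factor 1/2. *)
Lemma almost_norming f (e : R) : 0 < e -> e <= `|f| ->
  exists2 y, `|y| <= 1 & e / 2 <= `|f y|.
Proof.
move=> e0 ef; apply: contrapT => H.
suff : `|f| <= e / 2 by lra.
apply: supnorm_le => [|y y1]; first lra.
by rewrite leNgt; apply/negP => /ltW ?; apply: H; exists y.
Qed.

(** If [f] norms [y], evaluating [f + u] and [- f + u], both of norm at most [1 + r], at [y] gives
    [|u y| <= r |y|]. *)
Lemma vanishing_weakly (F : set_system (dual Y)) y (e : R) : Filter F ->
  vanishing F -> 0 < e -> \forall u \near F, `|(u : dual Y) y| < e.
Proof.
move=> FF vF e0; have [f f1 fy] := norming_functional y.
have y0 : 0 < `|y| + 1 by rewrite ltr_wpDl.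
pose r := e / (`|y| + 1).
have r0 : 0 < r by rewrite divr_gt0.
have ry : r * `|y| < e by rewrite /r mulrAC ltr_pdivrMr// ltr_pM2l//; lra.
have : \forall u \near F, `|f + u| < 1 + r by apply: vF; lra.
have : \forall u \near F, `|- f + u| < 1 + r by apply: vF; rewrite ?normrN; lra.
apply: filterS2 => u /ltW un /ltW up.
have bound (g : dual Y) : `|g| <= 1 + r -> `|g y| <= `|y| + r * `|y|.
  move=> gr; rewrite (le_trans (le_dual_norm _ _))//.
  by rewrite -[X in X + _]mul1r -mulrDl ler_wpM2r.
have H1 : `|f y + u y| <= `|y| + r * `|y| := bound _ up.
have H2 : `|- f y + u y| <= `|y| + r * `|y| := bound _ un.
move: H1 H2; rewrite fy !ler_norml ltr_norml => /andP[_ ?] /andP[? _].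
by apply/andP; split; lra.
Qed.

End dual_facts.

(** * Choosing sequences along a filter, and Cantor's diagonal argument *)

Section frequently.
Context {T : Type}.

Fixpoint history (u : nat -> T) n :=
  if n is m.+1 then u m :: history u m else [::].

Lemma size_history u n : size (history u n) = n.
Proof. by elim: n => //= n ->. Qed.

(** [Q] holds frequently and [P h] eventually, so they always meet and the next term can be chosen
    from the list [h] of past ones, newest first. *)
Lemma frequently_sequence (F : set_system T) (Q : set T) (P : seq T -> set T) :
  Filter F -> ~ F (~` Q) -> (forall h, F (P h)) ->
  exists u : nat -> T, forall n, Q (u n) /\ P (history u n) (u n).
Proof.
move=> FF FQ FP.
have /choice[next nextP] h : exists x, Q x /\ P h x.
  apply: contrapT => H; apply: FQ; apply: filterS (FP h) => x Px Qx.
  by apply: H; exists x.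
pose H n := iter n (fun h => next h :: h) [::].
exists (fun n => next (H n)) => n.
suff -> : history (fun n => next (H n)) n = H n by exact: nextP.
by elim: n => //= n ->.
Qed.

End frequently.

Lemma near_all (T : Type) (I : eqType) (F : set_system T) (s : seq I) (P : I -> set T) :
  Filter F -> (forall i, i \in s -> \forall x \near F, P i x) ->
  \forall x \near F, forall i, i \in s -> P i x.
Proof.
move=> FF; elim: s => [_|i s IH H]; first by apply: nearW.
have := H i (mem_head _ _); have := IH (fun j js => H j (@mem_behead _ (i :: s) j js)).
apply: filterS2 => x Hs Hi j; rewrite inE => /predU1P[->//|]; exact: Hs.
Qed.

(** A finite list, so that one set of the filter controls all these sums at each step. *)
Fixpoint subset_sums {V : nmodType} (h : seq V) : seq V :=
  if h is u :: h' then subset_sums h' ++ [seq s + u | s <- subset_sums h'] else [:: 0].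

Lemma mem_subset_sums (V : nmodType) (u : nat -> V) (A : pred nat) n :
  \sum_(0 <= i < n | A i) u i \in subset_sums (history u n).
Proof.
elim: n => [|n IH]; first by rewrite big_nil mem_head.
rewrite /= mem_cat big_mkcond big_nat_recr//= -big_mkcond.
case: (A n); last by rewrite addr0 IH.
by rewrite (map_f (fun s => s + u n) IH) orbT.
Qed.

(** Points of [D] close to [g A] and [g B] differ when [A <> B], which would inject the subsets of
    [nat] into [nat]. *)
Lemma cantor_separated (R : realType) (Z : normedModType R) (g : (nat -> bool) -> Z)
    (e : R) (D : set Z) : countable D ->
  (forall A, exists2 z, D z & `|g A - z| < e) ->
  ~ (forall A B, A <> B -> e + e <= `|g A - g B|).
Proof.
move=> /countable_injP[c cinj] Dg sep.
have /choice[h hP] A : exists z, D z /\ `|g A - z| < e.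
  by have [z] := Dg A; exists z.
have ch_inj A B : c (h A) = c (h B) -> A = B.
  move=> /cinj; rewrite !inE => /(_ (hP A).1 (hP B).1) hAB.
  apply: contrapT => /sep; apply/negP; rewrite -ltNge.
  apply: le_lt_trans (ler_distD (h A) _ _) _; apply: ltrD; first exact: (hP A).2.
  by rewrite hAB distrC; exact: (hP B).2.
(* The diagonal set: [n] belongs to it when [n] is the code of a set not containing [n]. *)
pose B n := `[< exists A, c (h A) = n /\ ~~ A n >].
have [BB|/negP nB] := boolP (B (c (h B))); last first.
  by apply: (nB); apply/asboolP; exists B; split => //; exact/negP.
have /asboolP[A [/ch_inj -> /negP]] := BB; exact.
Qed.

(** * Subset sums in a dual space *)

Section subset_sums.
Context {R : realType} {Y : normedModType R}.
Implicit Types (u : nat -> dual Y) (A B : nat -> bool).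

Lemma vanishing_sequences (F : set_system (dual Y)) :
  Filter F -> vanishing F -> ~ (F --> (0 : dual Y)) ->
  exists (c : R) u (y : nat -> Y), [/\ 0 < c, (forall n, `|y n| <= 1),
    (forall n, c <= `|u n (y n)|),
    (forall n j, (n < j)%N -> `|u j (y n)| <= c * (2^-1) ^+ j.+2) &
    (forall A n, `|\sum_(0 <= i < n | A i) u i| < 2)].
Proof.
move=> FF vF nF.
have [e e0 Fe] : exists2 e : R, 0 < e & ~ \forall u \near F, `|u| < e.
  apply: contrapT => H; apply: nF; apply/cvgr0Pnorm_lt => e e0.
  by apply: contrapT => He; apply: H; exists e.
(* One test vector per functional is fixed beforehand, so that the history need only record
   functionals; 0 is a dummy for small norms. *)
have /choice[w wP] (u : dual Y) :
    exists y : Y, `|y| <= 1 /\ (e <= `|u| -> e / 2 <= `|u y|).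
  have [eu|ue] := leP e `|u|; last by exists 0; rewrite normr0.
  by have [y y1 uy] := almost_norming e0 eu; exists y.
pose c := e / 2; have c0 : 0 < c by rewrite /c divr_gt0.
pose Q := [set u : dual Y | e <= `|u|].
(* The first condition is eventually true by [vanishing] with [M = 2], the second by
   [vanishing_weakly] at the earlier test vectors. *)
pose P (h : seq (dual Y)) := [set u : dual Y |
  (forall s, s \in subset_sums h -> `|s| < 2 -> `|s + u| < 2) /\
  (forall v, v \in h -> `|u (w v)| < c * (2^-1) ^+ (size h).+2)].
have FQ : ~ F (~` Q).
  move=> H; apply: Fe; apply: filterS H => u /= /negP.
  by rewrite -ltNge.
have FP h : F (P h).
  apply: filterI; apply: near_all => s sh.
    have [s2|s2] := boolP (`|s| < 2); last by apply: nearW.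
    by apply: filterS (vF _ _ _ s2) => //; rewrite ltr1n.
  apply: vanishing_weakly => //; rewrite mulr_gt0// exprn_gt0// invr_gt0//.
have [u uP] := frequently_sequence FF FQ FP.
exists c, u, (fun n => w (u n)); split => // [n|n|n j nj|A n].
- by case: (wP (u n)).
- by case: (wP (u n)) => _; apply; case: (uP n).
- have [_ [_ /(_ (u n))]] := uP j; rewrite size_history => H; apply/ltW/H.
  elim: j nj {H} => // j IH; rewrite ltnS leq_eqVlt inE => /predU1P[->|/IH ->].
    by rewrite eqxx.
  by rewrite orbT.
- elim: n => [|n IH]; first by rewrite big_nil normr0.
  rewrite big_mkcond big_nat_recr//= -big_mkcond.
  case: (A n); last by rewrite addr0.
  have [_ [+ _]] := uP n; apply => //; exact: mem_subset_sums.
Qed.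

(** Splitting the indices by the sign of [u i y] bounds the sum of [|u i y|] by [2 C |y|], so every
    subseries converges absolutely at [y]; the pointwise limit inherits linearity and the bound
    [C]. *)
Lemma subset_sum_limits u (C : R) :
  (forall A n, `|\sum_(0 <= i < n | A i) u i| <= C) ->
  exists f : (nat -> bool) -> dual Y, forall A (z : Y),
    (\sum_(0 <= i < n | A i) u i z) @[n --> \oo] --> (f A z : R).
Proof.
move=> uC.
have C0 : 0 <= C by apply: le_trans (uC xpredT 0%N).
have uyC A n (y : Y) : `|\sum_(0 <= i < n | A i) u i y| <= C * `|y|.
  rewrite -dual_apply_sum (le_trans (le_dual_norm _ _))// ler_wpM2r//.
pose v A (y : Y) i : R := if A i then u i y else 0.
have cv A y : cvgn (series (v A y)).
  have nE n : [normed series (v A y : R^o ^nat)] n = \sum_(0 <= k < n) `|v A y k| by [].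
  apply: (@normed_cvg R R^o); apply: nondecreasing_is_cvgn.
    apply/nondecreasing_seqP => n; rewrite !nE.
    by rewrite big_nat_recr//= lerDl.
  exists (C * `|y| + C * `|y|) => _ [n _ <-].
  pose pos i := 0 <= u i y.
  apply: le_trans (lerD (uyC pos n y) (uyC (predC pos) n y)).
  apply: le_trans (ler_normB _ _).
  rewrite nE.
  apply: le_trans (ler_norm _); rewrite [X in X - _]big_mkcond [X in _ - X]big_mkcond.
  rewrite -sumrB; apply: ler_sum => i _; rewrite /v /pos /=.
  case: (A i); case: (ger0P (u i y)) => ui /=; rewrite ?normr0 ?subr0 ?sub0r//.
  - by rewrite oppr_ge0 ltW.
have vE A y n : series (v A y) n = \sum_(0 <= i < n | A i) u i y.
  by rewrite /series/= [RHS]big_mkcond.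
pose g A (y : Y) : R^o := limn (series (v A y)).
have gl A : linear (g A).
  move=> a x y.
  have E : series (v A (a *: x + y)) = (fun n => a * series (v A x) n) \+ series (v A y).
    apply/funext => n; rewrite /= !vE mulr_sumr -big_split/=.
    by apply: eq_bigr => i _; rewrite dual_linear.
  apply: cvg_lim => //; rewrite E; apply: cvgD; last exact: cv.
  apply: cvgMl_tmp; exact: cv.
have gC A y : `|g A y| <= C * `|y|.
  rewrite -lim_norm; last exact: cv.
  apply: limr_le; first by apply: is_cvg_norm; exact: cv.
  by apply: nearW => n; rewrite /= vE.
exists (fun A => Dual (bounded_linear_dual (gl A) (gC A))) => A y.
rewrite [X in _ --> X]/(g A y).
have := cv A y; rewrite (_ : series _ = (fun n => \sum_(0 <= i < n | A i) u i y))//.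
by apply/funext => n.
Qed.

Lemma subset_sum_separated u (y : nat -> Y) (c : R) (f : (nat -> bool) -> dual Y) A B :
  (forall n, c <= `|u n (y n)|) ->
  (forall n j, (n < j)%N -> `|u j (y n)| <= c * (2^-1) ^+ j.+2) ->
  0 < c ->
  (forall A (z : Y),
    (\sum_(0 <= i < n | A i) u i z) @[n --> \oo] --> (f A z : R)) ->
  A <> B -> exists n, c / 2 <= `|(f A - f B) (y n)|.
Proof.
move=> uy uj c0 fl AB.
have [n ABn ABlt] : exists2 n, A n <> B n & forall i, (i < n)%N -> A i = B i.
  have : exists n, A n != B n.
    apply: contrapT => H; apply: AB; apply/funext => n; apply/eqP.
    by apply: contrapT => /negP ?; apply: H; exists n.
  move=> ex; case: (ex_minnP ex) => n /eqP ABn nmin; exists n => // i.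
  by apply: contraPP => /eqP /nmin; rewrite leqNgt => /negP.
exists n.
pose D N := \sum_(0 <= i < N | A i) u i (y n) - \sum_(0 <= i < N | B i) u i (y n).
have DS N : D N.+1 = D N + ((A N)%:R - (B N)%:R) * u N (y n).
  rewrite /D !(big_mkcond A) !(big_mkcond B) !big_nat_recr//= opprD addrACA.
  by congr (_ + _); case: (A N); case: (B N) => /=; ring.
have Dn : D n = 0.
  rewrite /D; apply/eqP; rewrite subr_eq0; apply/eqP.
  rewrite big_mkcond [RHS]big_mkcond; apply: eq_big_nat => i /andP[_ /ABlt] -> //.
(* The summand [2^-N] carries the induction: from [N] to [N + 1] the bound drops by exactly
   [c * 2^-(N+2)], the most that [uj] lets the new term take away. *)
have DN N : (n < N)%N -> c / 2 * (1 + 2^-1 ^+ N) <= `|D N|.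
  elim: N => // N IH; rewrite ltnS leq_eqVlt => /predU1P[<-|nN].
    rewrite DS Dn add0r normrM (_ : `|_ - _| = 1) ?mul1r; last first.
      by move: ABn; case: (A n); case: (B n) => //= _; rewrite ?subr0 ?sub0r ?normrN normr1.
    apply: le_trans (uy n); rewrite -mulrA -[leRHS]mulr1 ler_pM2l//.
    have : (2^-1 : R) ^+ n.+1 <= 1 by rewrite exprn_ile1//; lra.
    lra.
  have := IH nN; have := uj _ _ nN; rewrite DS.
  have : `|((A N)%:R - (B N)%:R) * u N (y n)| <= `|u N (y n)|.
    rewrite normrM ler_piMl//; case: (A N); case: (B N) => /=;
      by rewrite ?subrr ?subr0 ?sub0r ?normrN ?normr1 ?normr0.
  have := lerB_normD (D N) (((A N)%:R - (B N)%:R) * u N (y n)).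
  rewrite !exprS; move: (_ ^+ N) => t; nra.
have Dl : D N @[N --> \oo] --> (f A - f B) (y n).
  by rewrite [X in _ --> X]/(f A (y n) - f B (y n)); apply: cvgB; exact: fl.
have Dnl : `|D N| @[N --> \oo] --> `|(f A - f B) (y n)| by exact: cvg_norm.
rewrite -(cvg_lim _ Dnl)//; apply: limr_ge.
  by apply/cvg_ex; exists `|(f A - f B) (y n)|.
exists n.+1 => // N /= /DN; apply: le_trans.
by rewrite -[leLHS]mulr1 ler_pM2l ?divr_gt0// lerDl exprn_ge0.
Qed.

End subset_sums.

(** * Spans, separation and restriction *)

Section span.
Context {R : realType} {V : normedModType R}.
Implicit Types (y : nat -> V) (s : seq (R * nat)).

(** Repeated indices are allowed: sums become concatenations of lists, and the lists with rational
    coefficients form a countable type. *)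
Definition combination y s : V := \sum_(p <- s) p.1 *: y p.2.

Definition rat_coef (q : seq (rat * nat)) : seq (R * nat) :=
  [seq (ratr p.1, p.2) | p <- q].

Definition real_span y := range (combination y).

Definition rat_span y := range (fun q => combination y (rat_coef q)).

Lemma countable_rat_span y : countable (rat_span y).
Proof. exact: card_le_trans (card_image_le _ _) (countableP _). Qed.

Lemma span_submod y : submod_closed (mem (real_span y) : {pred V}).
Proof.
split; first by rewrite inE; exists [::]; rewrite // /combination big_nil.
move=> a _ _ /set_mem[s _ <-] /set_mem[t _ <-]; rewrite inE.
exists ([seq (a * p.1, p.2) | p <- s] ++ t) => //.
rewrite /combination big_cat big_map; congr (_ + _).
by rewrite scaler_sumr; apply: eq_bigr => p _; rewrite scalerA.
Qed.

Lemma mem_span y n : real_span y (y n).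
Proof. by exists [:: (1, n)] => //; rewrite /combination big_seq1 scale1r. Qed.

Lemma rat_combination y s (e : R) : 0 < e ->
  exists q, `|combination y s - combination y (rat_coef q)| < e.
Proof.
rewrite /combination; elim: s e => [|[a n] s IH] e e0.
  by exists [::]; rewrite !big_nil subrr normr0.
have e20 : 0 < e / 2 by rewrite divr_gt0.
have [q qs] := IH _ e20.
have y0 : 0 < `|y n| + 1 by rewrite ltr_wpDl.
(* The head uses half of the error, the tail the rest; adding 1 avoids a division by zero. *)
pose r := e / 2 / (`|y n| + 1).
have r0 : 0 < r by rewrite divr_gt0.
have ar : a < a + r by rewrite ltrDl.
have [b ab] := rat_in_itvoo ar.
exists ((b, n) :: q); rewrite /= !big_cons /= opprD addrACA -scalerBl.
rewrite (le_lt_trans (ler_normD _ _))// [ltRHS](splitr e) ler_ltD//.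
move: ab; rewrite in_itv/= normrZ => /andP[ab br].
have abr : `|a - ratr b| <= r by rewrite ler_norml; apply/andP; split; lra.
apply: (@le_trans _ _ (r * (`|y n| + 1))); first by rewrite ler_pM//; lra.
by rewrite /r mulfVK// gt_eqF.
Qed.

End span.

Section separation.
Context {R : realType} {V : normedModType R}.

(** The constraints ask for [f >= t * e] on [t *: x + M], [t >= 0]; the norm dominates them because
    [x] is at distance at least [e] from [M]. For [t = 0], at [m] and [- m], they force
    [f m = 0]. *)
Lemma separating_functional (M : {pred V}) (x : V) (e : R) :
  submod_closed M -> 0 <= e -> (forall m, m \in M -> e <= `|x - m|) ->
  exists2 f : dual V, (forall m, m \in M -> f m = 0) & e <= f x.
Proof.
move=> [M0 ML] e0 Mx.
have MZ a m : m \in M -> a *: m \in M by move=> Mm; rewrite -[_ *: _]addr0 ML.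
have MD m n : m \in M -> n \in M -> m + n \in M.
  by move=> Mm Mn; rewrite -[m]scale1r ML.
pose G := [set c : V * R | exists2 t : R, 0 <= t & c.1 - t *: x \in M /\ c.2 = t * e].
have cG : cone G.
  split.
  - by exists 0; rewrite //= scale0r mul0r subr0.
  - move=> m n _ _ [a a0 /= [Mm ->]] [b b0 /= [Mn ->]]; exists (a + b).
      by rewrite addr_ge0.
    by rewrite /= scalerDl opprD addrACA mulrDl MD.
  - move=> t m _ t0 [a a0 /= [Mm ->]]; exists (t * a); rewrite ?mulr_ge0//=.
    by rewrite -scalerA -scalerBr mulrA MZ.
have ps : sublinear (fun x : V => `|x|).
  by split => [|a y a0]; [exact: ler_normD|rewrite normrZ ger0_norm].
have [m _ [t t0 /= [Mm ->]]|f [lf fp Gf]] := cone_extension ps cG.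
  have [->|tn0] := eqVneq t 0; first by rewrite mul0r.
  have tp : 0 < t by rewrite lt_neqAle eq_sym tn0.
  rewrite mulrC -ler_pdivlMr// mulrC.
  have -> : t^-1 * `|m| = `|x - (- t^-1) *: (m - t *: x)|.
    rewrite scaleNr opprK scalerBr scalerK// addrC subrK normrZ.
    by rewrite gtr0_norm ?invr_gt0.
  exact/Mx/MZ.
have fN y : f (- y) = - f y by exact: linear_opp.
have fM m : m \in M -> 0 <= f m.
  by move=> Mm; apply: Gf; exists 0; rewrite //= scale0r subr0 mul0r.
have Hf : f \in @dual_pred R V.
  apply: (@bounded_linear_dual _ _ f 1) => // y; rewrite mul1r ler_norml fp andbT.
  by rewrite lerNl -fN -(normrN y).
exists (Dual Hf) => /= [m Mm|]; last first.
  by apply: Gf; exists 1; rewrite //= scale1r subrr mul1r.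
apply/eqP; rewrite eq_le fM// andbT -oppr_ge0 -fN fM//.
by rewrite -scaleN1r MZ.
Qed.

End separation.

Section restriction.
Context {R : realType} {Y : normedModType R} (M : submodClosed Y).

Lemma restriction_dual (f : dual Y) :
  (fun m : subspace_of M => f (val m)) \in @dual_pred R (subspace_of M).
Proof.
apply: (@bounded_linear_dual _ _ _ `|f|) => [a x y|x].
  by rewrite -dual_linear -linearP.
exact: le_dual_norm.
Qed.

Definition restriction (f : dual Y) : dual (subspace_of M) :=
  Dual (restriction_dual f).

Lemma restrictionB (f g : dual Y) :
  restriction f - restriction g = restriction (f - g).
Proof. exact/val_inj/funext. Qed.

Lemma restriction_norm_le (f : dual Y) : `|restriction f| <= `|f|.
Proof. by apply: dual_norm_le => // m; exact: (le_dual_norm f (val m)). Qed.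

(** Hahn-Banach with the graph of [g] as cone, dominated by [|g| |y|]. The graph being symmetric,
    the lower bounds [g n <= f n] become equalities. *)
Lemma restriction_surj (g : dual (subspace_of M)) : exists f, restriction f = g.
Proof.
pose p (y : Y) := `|g| * `|y|.
have ps : sublinear p.
  split=> [x y|a y a0]; rewrite /p.
    by rewrite -mulrDr ler_wpM2l// ler_normD.
  by rewrite normrZ ger0_norm// mulrCA.
pose G := range (fun m : subspace_of M => (val m, g m : R)).
have cG : cone G.
  split.
  - by exists 0 => //; rewrite (linear0 g).
  - move=> _ _ _ _ [m _ [<- <-]] [n _ [<- <-]]; exists (m + n) => //.
    by rewrite (linearD g).
  - by move=> a _ _ a0 [m _ [<- <-]]; exists (a *: m) => //; rewrite (linearZ_LR g).
have [_ _ [m _ [<- <-]]|f [lf fp Gf]] := cone_extension ps cG.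
  by rewrite (le_trans (ler_norm _))// le_dual_norm.
have fN y : f (- y) = - f y by exact: linear_opp.
have Hf : f \in @dual_pred R Y.
  apply: (@bounded_linear_dual _ _ f `|g|) => // y; rewrite ler_norml fp andbT.
  by rewrite lerNl -fN /p -(normrN y).
exists (Dual Hf); apply/val_inj/funext => m /=.
have le_f n : g n <= f (val n) by apply: Gf; exists n.
apply/eqP; rewrite eq_le le_f andbT -lerN2 -fN -linearN; exact: le_f.
Qed.

End restriction.

(** * Duals of Asplund spaces and reflexive spaces *)

Section rigid_duals.
Context {R : realType}.

Lemma separable_approx (X : normedModType R) : separable X ->
  exists2 D : set X, countable D &
    forall x (e : R), 0 < e -> exists2 y, D y & `|x - y| < e.
Proof. by move=> [D cD dD]; exists D => // x e; exact: dense_approx. Qed.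

Lemma separable_of_approx (X : normedModType R) (D : set X) : countable D ->
  (forall x (e : R), 0 < e -> exists2 y, D y & `|x - y| < e) -> separable X.
Proof.
move=> cD DX; exists D => // O [x Ox] oO.
have /nbhs_ballP[e /= e0 eO] : nbhs x O by exact: open_nbhs_nbhs.
have [y Dy xy] := DX x e e0; exists y; split => //.
by apply: eO; rewrite -ball_normE.
Qed.

(** Closed under linear combinations, not topologically; [asplund] ranges over subspaces in this
    sense. *)
Definition span_closed (V : normedModType R) (y : nat -> V) : submodClosed V :=
  HB.pack (mem (real_span y) : {pred V})
    (GRing.isSubmodClosed.Build R V (mem (real_span y)) (span_submod y)).

Lemma separable_span (V : normedModType R) (y : nat -> V) :
  separable (subspace_of (span_closed y)).
Proof.
have H q : combination y (rat_coef q) \in span_closed y.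
  by rewrite inE; exists (rat_coef q).
pose D := range (fun q => Subspace (H q)).
apply: (@separable_of_approx _ D).
  exact: card_le_trans (card_image_le _ _) (countableP _).
move=> x e e0; have /set_mem[s _ sx] := subspace_valP x.
have [q qs] := rat_combination y s e0.
exists (Subspace (H q)); first by exists q.
by rewrite sx in qs; exact: qs.
Qed.

(** The [y n] that separate the [f A] lie in the unit ball of their span, so the restrictions to it
    stay [c / 2] apart. *)
Lemma asplund_rigid (Y : completeNormedModType R) : asplund Y -> rigid (dual Y).
Proof.
move=> aY F FF vF; apply: contrapT => nF.
have [c [u [y [c0 y1 uy uj u2]]]] := vanishing_sequences FF vF nF.
have [f fl] := subset_sum_limits (fun A n => ltW (u2 A n)).
pose M := span_closed y.
have /separable_approx[D cD DM] := aY M (separable_span y).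
have c4 : 0 < c / 4 by rewrite divr_gt0.
apply: (@cantor_separated _ _ (fun A => restriction M (f A)) (c / 4) D cD).
  by move=> A; exact: DM.
move=> A B /(subset_sum_separated uy uj c0 fl)[n fAB].
have -> : c / 4 + c / 4 = c / 2 by lra.
have ynM : y n \in M by rewrite inE; exact: mem_span.
apply: (le_trans fAB); rewrite restrictionB.
have := le_dual_norm (restriction M (f A - f B)) (Subspace ynM).
move=> /le_trans; apply; rewrite -[leRHS]mulr1 ler_wpM2l//; exact: y1.
Qed.

Lemma bidual_isometry (X : normedModType R) (x : X) : `|bidual_embedding x| = `|x|.
Proof.
apply/eqP; rewrite eq_le; apply/andP; split.
  by apply: dual_norm_le => // f; rewrite mulrC; exact: (le_dual_norm f x).
have [f f1 fx] := norming_functional x.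
have fxn : `|f x| <= `|bidual_embedding x| * `|f| :=
  le_dual_norm (bidual_embedding x) f.
rewrite fx normr_id in fxn; apply: (le_trans fxn).
by rewrite -[leRHS]mulr1 ler_wpM2l.
Qed.

Lemma bidual_linear (X : normedModType R) : linear (@bidual_embedding R X).
Proof.
move=> a x y; apply/val_inj/funext => f.
exact: (dual_linear f a x y).
Qed.

HB.instance Definition _ (X : normedModType R) :=
  GRing.isLinear.Build R X (dual (dual X)) *:%R (@bidual_embedding R X)
    (@bidual_linear X).

Lemma reflexive_iso (X : normedModType R) : reflexive_space X ->
  isometrically_isomorphic X (dual (dual X)).
Proof.
move=> rX.
exists (@bidual_embedding R X : {linear X -> dual (dual X)}); first exact: bidual_isometry.
have /choice[g gK] := rX; exists g => // x.
apply/eqP; rewrite -subr_eq0 -normr_eq0 -bidual_isometry.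
by rewrite linearB /= gK subrr normr0.
Qed.

(** In the bidual, the [u n] are functionals on [dual X]. If [f A] were away from their span, some
    [G] would vanish on the [u n] but not at [f A]; reflexivity makes [G] the evaluation at a point
    of [dual X], where [f A] is a limit of sums equal to 0. *)
Lemma reflexive_rigid (X : normedModType R) : reflexive_space X -> rigid X.
Proof.
move=> rX; apply: (rigid_iso (reflexive_iso rX)).
move=> F FF vF; apply: contrapT => nF.
have [c [u [y [c0 y1 uy uj u2]]]] := vanishing_sequences FF vF nF.
have [f fl] := subset_sum_limits (fun A n => ltW (u2 A n)).
have c4 : 0 < c / 4 by rewrite divr_gt0.
apply: (@cantor_separated _ _ f (c / 4) _ (countable_rat_span u)); last first.
  move=> A B /(subset_sum_separated uy uj c0 fl)[n fAB].
  have -> : c / 4 + c / 4 = c / 2 by lra.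
  apply: (le_trans fAB); apply: (le_trans (le_dual_norm _ _)).
  by rewrite -[leRHS]mulr1 ler_wpM2l.
move=> A; apply: contrapT => far.
(* Half of [c / 4]; the other half pays for rational coefficients. *)
have [|m /set_mem[s _ <-]|G Gu GA] :=
  @separating_functional _ _ (mem (real_span u)) (f A) (c / 8) (span_submod u).
- by rewrite ltW// divr_gt0.
- have c8 : 0 < c / 8 by rewrite divr_gt0.
  rewrite leNgt; apply/negP => sfA; apply: far.
  have [q qs] := rat_combination u s c8.
  exists (combination u (rat_coef q)); first by exists q.
  rewrite (le_lt_trans (ler_distD (combination u s) _ _))//.
  by rewrite (_ : c / 4 = c / 8 + c / 8) ?ltrD//; lra.
have Hg : (fun x : X => G (bidual_embedding x)) \in @dual_pred R X.
  apply: (@bounded_linear_dual _ _ _ `|G|) => [a x z|x].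
    by rewrite bidual_linear linearP.
  by rewrite -bidual_isometry; exact: le_dual_norm.
have gE (h : dual (dual X)) : h (Dual Hg) = G h by have [x <-] := rX h.
suff : f A (Dual Hg) = 0 by rewrite gE => GA0; move: GA; rewrite GA0; lra.
have E : (fun n => \sum_(0 <= i < n | A i) u i (Dual Hg)) = cst 0.
  apply/funext => n; apply: big1 => i _; rewrite gE Gu// inE; exact: mem_span.
have := fl A (Dual Hg); rewrite E => H.
by rewrite -(cvg_lim (@Rhausdorff R) H) lim_cst.
Qed.

Lemma separable_surj (X Y : normedModType R) (f : X -> Y) :
  (forall x y, `|f x - f y| <= `|x - y|) -> (forall y, exists x, f x = y) ->
  separable X -> separable Y.
Proof.
move=> f1 fs /separable_approx[D cD DX]; apply: (@separable_of_approx _ (f @` D)).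
  exact: card_le_trans (card_image_le _ _) cD.
move=> y e e0; have [x <-] := fs y; have [z Dz xz] := DX x e e0.
by exists (f z); [exists z|exact: le_lt_trans (f1 _ _) xz].
Qed.

Lemma separable_dual_asplund (Y : completeNormedModType R) :
  separable (dual Y) -> asplund Y.
Proof.
move=> sY M _; apply: (@separable_surj _ _ (@restriction R Y M)) sY.
  by move=> f g; rewrite restrictionB restriction_norm_le.
exact: restriction_surj.
Qed.

End rigid_duals.

(** * Completion *)

Section completion.
Context {R : realType}.

Lemma cauchy_near (V : normedModType R) (F : set_system V) : ProperFilter F ->
  cauchy F -> forall e : R, 0 < e -> exists x, \forall u \near F, `|x - u| < e.
Proof.
move=> FF /cauchyP Fc e e0; have [x Fx] := Fc e e0; exists x.
by apply: filterS Fx => u; rewrite -ball_normE.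
Qed.

Lemma near_cauchy (V : normedModType R) (F : set_system V) : Filter F ->
  (forall e : R, 0 < e -> exists x, \forall u \near F, `|x - u| < e) -> cauchy F.
Proof.
move=> FF Fc; apply: cauchy_exP => e e0; have [x Fx] := Fc e e0; exists x.
by apply: filterS Fx => u; rewrite -ball_normE.
Qed.

(** Pointwise limits exist by completeness of [R]; passing to the limit in [|f x - u x| <= r |x|]
    makes the convergence uniform on the unit ball. *)
Lemma dual_cauchy_cvg (V : normedModType R) (F : set_system (dual V)) :
  ProperFilter F -> cauchy F -> exists f : dual V, F --> f.
Proof.
move=> FF Fc; have Fn := cauchy_near FF Fc.
have ev_cvg (x : V) : cvg ((fun u : dual V => u x : R^o) @ F).
  apply: cauchy_cvg; apply: near_cauchy => e e0.
  have x0 : 0 < `|x| + 1 by rewrite ltr_wpDl.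
  have [f Ff] := Fn (e / (`|x| + 1)) (divr_gt0 e0 x0).
  exists (f x); rewrite near_map; apply: filterS Ff => u fu.
  apply: le_lt_trans (le_dual_norm (f - u) x) _.
  apply: (@le_lt_trans _ _ (e / (`|x| + 1) * `|x|)); first by rewrite ler_wpM2r// ltW.
  by rewrite mulrAC ltr_pdivrMr// ltr_pM2l// ltrDl.
pose g (x : V) : R^o := lim ((fun u : dual V => u x : R^o) @ F).
have gl : linear g.
  move=> a x y; apply: cvg_lim => //.
  rewrite (_ : (fun u : dual V => _) = (fun u : dual V => a *: (u x : R^o) + u y)).
    apply: cvgD; last exact: ev_cvg.
    by apply: cvgZl_tmp; exact: ev_cvg.
  by apply/funext => u; rewrite dual_linear.
have g_le (f : dual V) (r : R) (x : V) : (\forall u \near F, `|f - u| < r) ->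
    `|f x - g x| <= r * `|x|.
  move=> Ff.
  have cfg : (fun u : dual V => `|f x - u x|) @ F --> `|f x - g x|.
    by apply: cvg_norm; apply: cvgB; [exact: cvg_cst|exact: ev_cvg].
  rewrite -(cvg_lim _ cfg)//; apply: limr_le; first by apply/cvg_ex; exists `|f x - g x|.
  apply: filterS Ff => u fu; apply: le_trans (le_dual_norm (f - u) x) _.
  by rewrite ler_wpM2r// ltW.
have Hg : g \in @dual_pred R V.
  have [f Ff] := Fn 1 ltr01.
  apply: (@bounded_linear_dual _ _ g (`|f| + 1) gl) => x.
  rewrite -[g x](subKr (f x)) (le_trans (ler_normB _ _))// mulrDl lerD//.
    exact: le_dual_norm.
  exact: g_le.
exists (Dual Hg); apply/cvgrPdist_lt => e e0.
have e2 : 0 < e / 2 by rewrite divr_gt0.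
have [f Ff] := Fn _ e2.
have fg : `|f - Dual Hg| <= e / 2.
  by apply: dual_norm_le => [|x]; [exact: ltW|exact: g_le].
apply: filterS Ff => u fu; rewrite (le_lt_trans (ler_distD f _ _))//.
by rewrite distrC [ltRHS]splitr ler_ltD.
Qed.

Variable Y : normedModType R.

(** The closure of the canonical image of [Y] in its bidual, a complete space. *)
Definition completion_pred : {pred dual (dual Y)} :=
  mem [set F | forall e : R, 0 < e -> exists y : Y, `|F - bidual_embedding y| < e].

Lemma completion_submod_closed : submod_closed completion_pred.
Proof.
split.
  rewrite inE => e e0; exists 0.
  by rewrite linear0 subrr normr0.
move=> a F G /set_mem FY /set_mem GY; apply/mem_set => e e0.
have a0 : 0 < `|a| + 1 by rewrite ltr_wpDl.
have e2 : 0 < e / 2 by rewrite divr_gt0.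
have [x Fx] := FY (e / 2 / (`|a| + 1)) (divr_gt0 e2 a0).
have [y Gy] := GY _ e2.
exists (a *: x + y); rewrite linearP opprD addrACA -scalerBr.
rewrite (le_lt_trans (ler_normD _ _))// [ltRHS]splitr ler_ltD// normrZ.
apply: (@le_trans _ _ ((`|a| + 1) * (e / 2 / (`|a| + 1)))).
  by rewrite ler_pM// ?lerDl// ltW.
by rewrite mulrC mulfVK// gt_eqF.
Qed.

Definition completion_submod : submodClosed (dual (dual Y)) :=
  HB.pack completion_pred
    (GRing.isSubmodClosed.Build R _ completion_pred completion_submod_closed).

Local Notation Yc := (subspace_of completion_submod).

Lemma completion_cauchy_cvg (F : set_system Yc) : ProperFilter F -> cauchy F -> cvg F.
Proof.
move=> FF Fc; have Fn := cauchy_near FF Fc.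
have [|f Ff] := @dual_cauchy_cvg (dual Y) (@subspace_val _ _ completion_submod @ F) _.
  apply: near_cauchy => e e0; have [x Fx] := Fn e e0.
  by exists (val x); rewrite near_map.
have Hf : f \in completion_submod.
  rewrite inE => e e0; have e2 : 0 < e / 2 by rewrite divr_gt0.
  move/cvgrPdist_lt : Ff => /(_ _ e2); rewrite near_map => /filter_ex[x fx].
  have /set_mem/(_ _ e2)[y xy] := subspace_valP x; exists y.
  by rewrite (le_lt_trans (ler_distD (subspace_val x) _ _))// [ltRHS]splitr ltrD.
apply/cvg_ex; exists (Subspace Hf); apply/cvgrPdist_lt => e e0.
by move/cvgrPdist_lt : Ff => /(_ _ e0); rewrite near_map.
Qed.

Definition completion : completeNormedModType R :=
  HB.pack Yc (Uniform_isComplete.Build Yc completion_cauchy_cvg).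

(** A functional on [Y] acts on the completion by evaluation; the inverse map restricts functionals
    to the dense image of [Y]. *)
Lemma dual_completion : isometrically_isomorphic (dual Y) (dual completion).
Proof.
have He (f : dual Y) : (fun F : Yc => (val F : dual (dual Y)) f) \in @dual_pred R Yc.
  apply: (@bounded_linear_dual _ _ _ `|f|) => [a F G|F].
    by rewrite linearP.
  by rewrite mulrC; exact: (le_dual_norm (val F) f).
pose E (f : dual Y) : dual completion := Dual (He f).
have El : linear E.
  by move=> a f g; apply/val_inj/funext => F; exact: (dual_linear (val F) a f g).
pose EL : {linear dual Y -> dual completion} := HB.pack E
  (GRing.isLinear.Build R (dual Y) (dual completion) *:%R E El).
have jP y : bidual_embedding y \in completion_submod.
  by rewrite inE => e e0; exists y; rewrite subrr normr0.
pose j y : Yc := Subspace (jP y).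
have jl : linear j by move=> a x y; apply: val_inj; exact: bidual_linear.
have jn y : `|j y| = `|y| by exact: bidual_isometry.
have En f : `|E f| = `|f|.
  apply/eqP; rewrite eq_le; apply/andP; split.
    apply: dual_norm_le => // F; rewrite mulrC; exact: (le_dual_norm (val F) f).
  apply: dual_norm_le => // y; rewrite -jn; exact: (le_dual_norm (E f) (j y)).
have Hr (g : dual completion) : (fun y => g (j y)) \in @dual_pred R Y.
  apply: (@bounded_linear_dual _ _ _ `|g|) => [a x y|y].
    by rewrite jl; exact: (dual_linear g).
  by rewrite -jn; exact: le_dual_norm.
exists EL => //; exists (fun g => Dual (Hr g)).
  by move=> f; apply/val_inj/funext.
move=> g; apply/val_inj/funext => F.
(* [h] vanishes on every [j y]; one that is closer to [F] than [|h F| / (|h| + 1)] contradicts [h F]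
   being nonzero. *)
pose h := E (Dual (Hr g)) - g.
suff : h F = 0 by move/eqP; rewrite subr_eq0 => /eqP.
apply/eqP; rewrite -normr_eq0 -[_ == _]negbK; apply/negP => hF.
have hF0 : 0 < `|h F| by rewrite lt_neqAle eq_sym hF normr_ge0.
have h0 : 0 < `|h| + 1 by rewrite ltr_wpDl.
have /set_mem/(_ _ (divr_gt0 hF0 h0))[y Fy] := subspace_valP F.
have hj : h (j y) = 0 by exact: subrr.
have hFy : h (F - j y) = h F by rewrite (linearB h F (j y)) -[RHS]subr0 -[in RHS]hj.
have := le_dual_norm h (F - j y); rewrite hFy leNgt => /negP; apply.
have Fy' : `|F - j y| < `|h F| / (`|h| + 1) by exact: Fy.
apply: (@le_lt_trans _ _ (`|h| * (`|h F| / (`|h| + 1)))).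
  by rewrite ler_wpM2l// ltW.
by rewrite mulrCA gtr_pMr// ltr_pdivrMr// mul1r ltrDl.
Qed.

End completion.

(** * Transport along isometric isomorphisms, and the conclusion *)

Lemma iso_trans (R : realType) (X Y Z : normedModType R) :
  isometrically_isomorphic X Y -> isometrically_isomorphic Y Z ->
  isometrically_isomorphic X Z.
Proof.
move=> [f fn fb] [g gn gb]; exists (g \o f : {linear X -> Z}) => [x|].
  by rewrite /= gn fn.
exact: bij_comp.
Qed.

Lemma iso_separable (R : realType) (X Y : normedModType R) :
  isometrically_isomorphic X Y -> separable X -> separable Y.
Proof.
move=> [f fn [g fK gK]]; apply: (@separable_surj _ _ _ f) => [x y|y].
  by rewrite -linearB fn.
by exists (g y).
Qed.

(** The second conjunct is the claim that separable duals fall under the Asplund case. *)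
Theorem corollary14 (R : realType) :
  (forall (X : normedModType R) (S : set X) (T : X -> X),
     dense S -> step_isometry S T ->
     reflexive_space X \/
     (exists2 Y : completeNormedModType R,
        asplund Y & isometrically_isomorphic X (dual Y)) \/
     (exists (K : topologicalType) (cK : compact [set: K]),
        isometrically_isomorphic X (C R cK)) \/
     (exists K : topologicalType, isometrically_isomorphic X (Cb R K)) \/
     isometrically_isomorphic X (L1_01 R) ->
     {within S, continuous T}) /\
  (forall X : normedModType R,
     (exists Y : normedModType R, isometrically_isomorphic X (dual Y)) ->
     separable X ->
     exists2 Y : completeNormedModType R,
       asplund Y & isometrically_isomorphic X (dual Y)).
Proof.
split=> [X S T dS iT H|X [Y XY] sX].
  apply: rigid_continuous iT => //.
  case: H => [|[[Y aY]|[[K [cK]]|[[K]|]]]].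
  - exact: reflexive_rigid.
  - by move/rigid_iso; apply; exact: asplund_rigid.
  - by move/rigid_iso; apply; exact: rigid_C.
  - by move/rigid_iso; apply; exact: rigid_Cb.
  - by move/rigid_iso; apply; exact: rigid_L1_01.
have XYc := iso_trans XY (dual_completion Y).
exists (completion Y) => //; apply: separable_dual_asplund.
exact: iso_separable XYc sX.
Qed.
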